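(* Let $\mathcal{I}=\{0,\dots,M-1\}$ be a finite alphabet, let $\{S_i\}_{i\in\mathcal{I}}$ be contracting similarities of $\mathbb{R}^n$, each mapping $[0,1]^n$ into itself, and let $A$ be an irreducible $M\times M$ transition matrix with entries in $\{0,1\}$. Let $F_A=\Pi(\Sigma_A)$ and let $s=\dim_{\mathrm{H}}F_A$. Then for every finite word $\mathbf{i}\in\mathcal{I}^*$, $$\mathcal{H}^s_\infty\big(F_A^{\mathbf{i}}\big)=\mathcal{H}^s\big(F_A^{\mathbf{i}}\big).$$ Moreover, for every $i\in\mathcal{I}$, $$\mathcal{H}^s_\infty\Big(\bigcup_{j\in\mathcal{I}:\,A_{i,j}=1}F_A^{j}\Big)=\mathcal{H}^s\Big(\bigcup_{j\in\mathcal{I}:\,A_{i,j}=1}F_A^{j}\Big).$$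
   Context: Hausdorff measure and content: for $F\subseteq\mathbb{R}^n$, $s\ge 0$, $\delta>0$, $\mathcal{H}^s_\delta(F)$ is the infimum of $\sum_k \mathrm{diam}(U_k)^s$ over countable covers $\{U_k\}$ of $F$ by sets of diameter at most $\delta$; $\mathcal{H}^s(F)=\lim_{\delta\to0}\mathcal{H}^s_\delta(F)$; the Hausdorff content $\mathcal{H}^s_\infty(F)$ is the infimum of $\sum_k\mathrm{diam}(U_k)^s$ over all countable covers of $F$ by arbitrary sets. (When $s=0$: $\mathrm{diam}(U)^0=1$ for nonempty $U$ and $\mathrm{diam}(\emptyset)^0=0$.) $\dim_{\mathrm H}$ is Hausdorff dimension. Symbolic setting: $\Sigma=\mathcal{I}^{\{0,1,2,\dots\}}$ is the set of infinite sequences $\alpha=(\alpha_0,\alpha_1,\dots)$ over $\mathcal{I}$; $\alpha|_k=(\alpha_0,\dots,\alpha_{k-1})$. $\mathcal{I}^*=\bigcup_{k\ge1}\mathcal{I}^k$ is the set of finite (nonempty) words. For $\mathbf{i}\in\mathcal{I}^k$, $[\mathbf{i}]=\{\alpha\in\Sigma:\alpha|_k=\mathbf{i}\}$. The subshift of finite type is $\Sigma_A=\{\alpha\in\Sigma: A_{\alpha_l,\alpha_{l+1}}=1\text{ for all }l\ge0\}$. $A$ is irreducible if for all $i,j\in\mathcal{I}$ there is a positive integer $m$ with $(A^m)_{i,j}>0$. Each $S_i$ is a similarity with contraction ratio $r_i\in(0,1)$; for $\mathbf{i}=(i_0,\dots,i_{k-1})$, $S_{\mathbf{i}}=S_{i_0}\circ\cdots\circ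 S_{i_{k-1}}$. The coding map $\Pi:\Sigma\to[0,1]^n$ is given by $\{\Pi(\alpha)\}=\bigcap_{k\ge1}S_{\alpha|_k}([0,1]^n)$. Finally $F_A=\Pi(\Sigma_A)$ and $F_A^{\mathbf{i}}=\Pi(\Sigma_A\cap[\mathbf{i}])$ (possibly empty). No separation condition is assumed. *)

(* Defs.v *)
From HB Require Import structures.
From mathcomp Require Import all_boot all_order all_algebra.
From mathcomp Require Import all_classical all_reals all_analysis.

Set Implicit Arguments.
Unset Strict Implicit.
Unset Printing Implicit Defensive.

Import Order.TTheory GRing.Theory Num.Theory.
Import numFieldNormedType.Exports.

Local Open Scope classical_set_scope.
Local Open Scope ring_scope.
Local Open Scope ereal_scope.

(* The library norm on ['rV[R]_n] is the sup norm, so the Euclidean distance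
   is defined here. *)
Definition edist (R : realType) (n : nat) (x y : 'rV[R]_n) : R :=
  Num.sqrt (\sum_(j < n) (x ord0 j - y ord0 j) ^+ 2)%R.

(* The element 0 is adjoined because [ereal_sup set0 = -oo]; it only matters
   for the empty set, whose diameter is then 0. *)
Definition diam (R : realType) (n : nat) (U : set 'rV[R]_n) : \bar R :=
  ereal_sup (0 |` [set d | exists x y, [/\ U x, U y & d = (edist x y)%:E]]).

(* diam(U)^s, with value 0 for the empty set even when s = 0; for nonempty U,
   [poweR] gives diam(U)^0 = 1, and +oo when diam(U) = +oo and s > 0. *)
Definition diam_pow (R : realType) (n : nat) (s : R) (U : set 'rV[R]_n)
    : \bar R :=
  if `[< U = set0 >] then 0 else poweR (diam U) s.

(* Finite covers are included: pad with empty sets.  [delta = +oo] imposes no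
   restriction on the covering sets. *)
Definition hausdorff_pre (R : realType) (n : nat) (s : R) (delta : \bar R)
    (F : set 'rV[R]_n) : \bar R :=
  ereal_inf [set \sum_(0 <= k <oo) diam_pow s (U k) | U in
    [set U : nat -> set 'rV[R]_n |
       F `<=` \bigcup_k U k /\ forall k, diam (U k) <= delta]].

Definition hausdorff_content (R : realType) (n : nat) (s : R)
    (F : set 'rV[R]_n) : \bar R :=
  hausdorff_pre s +oo F.

Definition hausdorff_measure (R : realType) (n : nat) (s : R)
    (F : set 'rV[R]_n) : \bar R :=
  lim (hausdorff_pre s delta%:E F @[delta --> (0%R : R)^'+]).

(* A real infimum suffices: the set is nonempty for every F in R^n, since it
   contains every t > n. *)
Definition hausdorff_dim (R : realType) (n : nat) (F : set 'rV[R]_n) : R :=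
  inf [set t : R | (0 <= t)%R /\ hausdorff_measure t F = 0].

Definition contracting_similarity (R : realType) (n : nat)
    (f : 'rV[R]_n -> 'rV[R]_n) : Prop :=
  exists2 r : R, (0 < r < 1)%R &
    forall x y, edist (f x) (f y) = (r * edist x y)%R.

Definition unit_cube (R : realType) (n : nat) : set 'rV[R]_n :=
  [set x | forall j, (0 <= x ord0 j <= 1)%R].
Arguments unit_cube {R n}.

Definition zero_one_matrix (M : nat) (A : 'M[nat]_M) : Prop :=
  forall i j, A i j = 0%N \/ A i j = 1%N.

Definition irreducible_matrix (M : nat) (A : 'M[nat]_M) : Prop :=
  forall i j, exists2 m : nat, (0 < m)%N & (0 < (A ^+ m)%R i j)%N.

(* alpha|_k = (alpha_0, ..., alpha_(k-1)) *)
Definition prefix_word (M : nat) (alpha : nat -> 'I_M) (k : nat) : seq 'I_M :=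
  mkseq alpha k.

Definition cylinder (M : nat) (w : seq 'I_M) : set (nat -> 'I_M) :=
  [set alpha | prefix_word alpha (size w) = w].

Definition subshift (M : nat) (A : 'M[nat]_M) : set (nat -> 'I_M) :=
  [set alpha | forall l, A (alpha l) (alpha l.+1) = 1%N].

Definition word_map (R : realType) (n M : nat)
    (S : 'I_M -> 'rV[R]_n -> 'rV[R]_n) (w : seq 'I_M) : 'rV[R]_n -> 'rV[R]_n :=
  foldr (fun i f => S i \o f) id w.

(* [xget] extracts the unique point of the intersection; 0 is its default
   value on the empty set, which does not occur for contracting similarities
   mapping the unit cube into itself. *)
Definition coding (R : realType) (n M : nat)
    (S : 'I_M -> 'rV[R]_n -> 'rV[R]_n) (alpha : nat -> 'I_M) : 'rV[R]_n :=
  xget 0%R (\bigcap_(k in [set k | (0 < k)%N])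
              (word_map S (prefix_word alpha k) @` unit_cube)).

Definition sft_attractor (R : realType) (n M : nat)
    (S : 'I_M -> 'rV[R]_n -> 'rV[R]_n) (A : 'M[nat]_M) : set 'rV[R]_n :=
  coding S @` subshift A.

Definition sft_attractor_cyl (R : realType) (n M : nat)
    (S : 'I_M -> 'rV[R]_n -> 'rV[R]_n) (A : 'M[nat]_M) (w : seq 'I_M)
    : set 'rV[R]_n :=
  coding S @` (subshift A `&` cylinder w).

(* Main.v *)
(* Let K be the piece F_A^i.  The copies S_w(K), for w a loop at i, lie in K,
   and every point of K has, at every small scale, a copy of K of comparable
   size nearby.  If finitely many copies are disjoint then the s-th powers of
   their ratios add up to at most 1: otherwise the sub-IFS they form would have
   dimension larger than s.  Vitali's covering argument therefore yields a
   disjoint family of small copies with a convergent sum of ratios^s <= 1.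
   Covering finitely many of them by scaled versions of an arbitrary cover of K,
   and the rest of K by enlargements of the remaining copies, whose cost is the
   tail of the series, shows H^s_delta(K) <= H^s_oo(K) for every delta.  The
   other sets are images or preimages of these pieces under the similarities. *)

From mathcomp Require Import all_boot all_order all_algebra.
From mathcomp Require Import all_classical all_reals all_analysis.
From mathcomp Require Import ring lra.
Require Import Defs.

Set Implicit Arguments.
Unset Strict Implicit.
Unset Printing Implicit Defensive.

Import Order.TTheory GRing.Theory Num.Theory.

Local Open Scope classical_set_scope.
Local Open Scope ring_scope.

(** * Euclidean distance *)

(** The constant 1 in the bound for disjoint copies is decisive: the finitely many main copies are
    covered at cost at most H^s_oo(K), with no extra factor, and the constants lost by Vitali
    enlargement multiply only a tail. Covers of K by large sets scale down for free, since their
    sets can first be cut to K. The bound holds for the following reason. If the sum exceeded 1 at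
    s, it would stay at least 1 up to some s + h, while H^t_oo(K) = 0 for some t < s + h. But
    finitely many disjoint compact copies are separated by a positive gap, and this gap bounds the
    cost of every cover of K from below. The lower bound comes from a descent through smaller and
    smaller copies and uses no self-similar measure. About s, only the inclusion of K in F_A is
    used, not the dimension of K itself. Irreducibility provides one return word to i per letter; as
    these are finitely many, closing a prefix into a loop changes its ratio by a bounded factor
    only. *)

Lemma ler_sum_mul_sqrt (R : realType) (n : nat) (a b : 'I_n -> R) :
  \sum_j a j * b j <= Num.sqrt (\sum_j a j ^+ 2) * Num.sqrt (\sum_j b j ^+ 2).
Proof.
set X := \sum_j a j ^+ 2; set Y := \sum_j b j ^+ 2; set Z := \sum_j _.
have X0 : 0 <= X by apply: sumr_ge0 => j _; exact: sqr_ge0.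
have Y0 : 0 <= Y by apply: sumr_ge0 => j _; exact: sqr_ge0.
have quad (u v : R) : 0 <= u ^+ 2 * X - u * v * Z *+ 2 + v ^+ 2 * Y.
  have -> : u ^+ 2 * X - u * v * Z *+ 2 + v ^+ 2 * Y =
      \sum_j (u * a j - v * b j) ^+ 2.
    rewrite /X /Y /Z -mulrnAr !mulr_sumr -sumrMnl mulr_sumr -sumrB -big_split /=.
    by apply: eq_bigr => j _; ring.
  by apply: sumr_ge0 => j _; exact: sqr_ge0.
set x := Num.sqrt X; set y := Num.sqrt Y.
have x0 : 0 <= x by exact: sqrtr_ge0.
have y0 : 0 <= y by exact: sqrtr_ge0.
have Xx : X = x ^+ 2 by rewrite sqr_sqrtr.
have Yy : Y = y ^+ 2 by rewrite sqr_sqrtr.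
have := quad y x; rewrite Xx Yy => h.
have [xy0|xy0] := ltP 0 (x * y).
  have : 0 <= (x * y) * (x * y - Z) by nra.
  by rewrite pmulr_rge0 // subr_ge0.
have xy : x * y = 0 by apply/le_anti; rewrite xy0 mulr_ge0.
(* One sum of squares vanishes, so the form is affine in one of its parameters; for positive [Z] the
   value chosen below makes it negative. *)
rewrite xy; have [//|Z0] := leP Z 0.
have /eqP := xy; rewrite mulf_eq0 => /orP[] /eqP e0.
  have := quad ((y ^+ 2 + 1) / Z) 1.
  rewrite Xx Yy e0 mulr1 divfK ?gt_eqF// => h1; nra.
have := quad 1 ((x ^+ 2 + 1) / Z).
rewrite Xx Yy e0 mul1r divfK ?gt_eqF// => h1; nra.
Qed.

Section Edist.
Variables (R : realType) (n : nat).
Implicit Types x y z : 'rV[R]_n.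

Lemma edist_ge0 x y : 0 <= edist x y.
Proof. exact: sqrtr_ge0. Qed.

Lemma edistxx x : edist x x = 0.
Proof. by rewrite /edist big1 ?sqrtr0// => j _; rewrite subrr expr0n. Qed.

Lemma edistC x y : edist x y = edist y x.
Proof. by congr Num.sqrt; apply: eq_bigr => j _; rewrite -opprB sqrrN. Qed.

Lemma sqr_edist x y : edist x y ^+ 2 = \sum_(j < n) (x ord0 j - y ord0 j) ^+ 2.
Proof. by rewrite sqr_sqrtr// sumr_ge0// => j _; exact: sqr_ge0. Qed.

Lemma edist_triangle y x z : edist x z <= edist x y + edist y z.
Proof.
rewrite -(@ler_pXn2r _ 2)// ?nnegrE ?edist_ge0// ?addr_ge0 ?edist_ge0//.
rewrite sqrrD !sqr_edist.
have := ler_sum_mul_sqrt (fun j => x ord0 j - y ord0 j)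
  (fun j => y ord0 j - z ord0 j).
rewrite -/(edist x y) -/(edist y z) => h.
have -> : \sum_(j < n) (x ord0 j - z ord0 j) ^+ 2 =
  \sum_(j < n) (x ord0 j - y ord0 j) ^+ 2
  + (\sum_(j < n) (x ord0 j - y ord0 j) * (y ord0 j - z ord0 j)) *+ 2
  + \sum_(j < n) (y ord0 j - z ord0 j) ^+ 2.
  rewrite -sumrMnl -!big_split /=; apply: eq_bigr => j _; ring.
by rewrite lerD2r lerD2l lerMn2r.
Qed.

Lemma ler_coord_edist x y j : `|x ord0 j - y ord0 j| <= edist x y.
Proof.
rewrite -sqrtr_sqr ler_wsqrtr// (bigD1 j)//= lerDl.
by apply: sumr_ge0 => k _; exact: sqr_ge0.
Qed.

Lemma edist_le_coord x y (c : R) :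
  (forall j, `|x ord0 j - y ord0 j| <= c) -> edist x y <= n%:R * c.
Proof.
move=> h; case: (posnP n) => [n0|n0].
  rewrite /edist big1 ?sqrtr0 => [|j]; last by have := ltn_ord j; rewrite {2}n0.
  by rewrite n0 mul0r.
have c0 : 0 <= c by apply: le_trans (h (Ordinal n0)).
rewrite -(@ler_pXn2r _ 2)// ?nnegrE ?edist_ge0// ?mulr_ge0//.
rewrite sqr_edist; apply: (@le_trans _ _ (\sum_(j < n) c ^+ 2)).
  by apply: ler_sum => j _; rewrite -real_normK ?num_real// ler_pXn2r ?nnegrE.
rewrite sumr_const card_ord -[leLHS]mulr_natl exprMn.
by rewrite ler_wpM2r ?sqr_ge0// expr2 ler_peMl ?ler1n.
Qed.

Lemma edist_small_eq x y : (forall e, 0 < e -> edist x y < e) -> x = y.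
Proof.
move=> h; apply/rowP => j; apply/eqP; rewrite -subr_eq0 -normr_le0.
apply: (le_trans (ler_coord_edist x y j)).
by apply/ler_addgt0Pl => e e0; rewrite addr0 ltW// h.
Qed.

(* The limit is the coordinatewise supremum of the lower bounds
   [z m - e m]. *)
Lemma edist_complete (z : nat -> 'rV[R]_n) (e : nat -> R) :
  (forall m p, (m <= p)%N -> edist (z m) (z p) <= e m) ->
  exists x, forall m, edist (z m) x <= n%:R * e m.
Proof.
move=> ze.
pose B j := [set z m ord0 j - e m | m in [set: nat]].
have e0 m : 0 <= e m by rewrite -(edistxx (z m)) ze.
have zz j m p : z m ord0 j - e m <= z p ord0 j + e p.
  have [mp|pm] := leqP m p.
    have := le_trans (ler_coord_edist _ _ j) (ze _ _ mp).
    by rewrite ler_norml => /andP[? ?]; have := e0 p; lra.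
  have := le_trans (ler_coord_edist _ _ j) (ze _ _ (ltnW pm)).
  by rewrite ler_norml => /andP[? ?]; have := e0 m; lra.
have Bub j p : ubound (B j) (z p ord0 j + e p) by move=> _ [m _ <-]; exact: zz.
exists (\row_j sup (B j)) => m; apply: edist_le_coord => j; rewrite mxE.
have h1 : sup (B j) <= z m ord0 j + e m.
  by apply: ge_sup => //; exists (z 0%N ord0 j - e 0%N); exists 0%N.
have h2 : z m ord0 j - e m <= sup (B j).
  by apply: ub_le_sup; [exists (z 0%N ord0 j + e 0%N) | exists m].
by rewrite ler_norml; lra.
Qed.

End Edist.

(** * Hausdorff premeasures *)

Section HausdorffPre.
Variables (R : realType) (n : nat).
Implicit Types (x y : 'rV[R]_n) (U V X Y : set 'rV[R]_n) (s c : R) (d : \bar R).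
Local Open Scope ereal_scope.

Lemma diam_ge0 U : 0 <= diam U.
Proof. by apply: ereal_sup_ubound; left. Qed.

Lemma edist_le_diam U x y : U x -> U y -> (edist x y)%:E <= diam U.
Proof. by move=> Ux Uy; apply: ereal_sup_ubound; right; exists x, y. Qed.

Lemma diam_le U d :
  0 <= d -> (forall x y, U x -> U y -> (edist x y)%:E <= d) -> diam U <= d.
Proof. by move=> d0 h; apply: ge_ereal_sup => _ [->//|[x [y [Ux Uy ->]]]]; exact: h. Qed.

Lemma diam_subset U V : U `<=` V -> diam U <= diam V.
Proof.
by move=> UV; apply: diam_le (diam_ge0 _) _ => x y /UV ? /UV ?; exact: edist_le_diam.
Qed.

Lemma diam_set0 : diam (@set0 'rV[R]_n) = 0.
Proof. by apply/le_anti; rewrite diam_ge0 andbT; apply: diam_le. Qed.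

Lemma diam_pow_ge0 s U : 0 <= diam_pow s U.
Proof. by rewrite /diam_pow; case: ifP => // _; exact: poweR_ge0. Qed.

Lemma diam_pow_set0 s : diam_pow s (@set0 'rV[R]_n) = 0.
Proof. by rewrite /diam_pow asboolT. Qed.

Lemma diam_pow_neq0 s U : U !=set0 -> diam_pow s U = diam U `^ s.
Proof. by move=> /set0P/eqP U0; rewrite /diam_pow asboolF. Qed.

Lemma le_poweR s (x y : \bar R) : (0 <= s)%R -> 0 <= x -> x <= y -> x `^ s <= y `^ s.
Proof.
move=> s0 x0 xy; apply: gt0_ler_poweR => //;
  by rewrite in_itv/= ?x0 ?leey// (le_trans x0 xy).
Qed.

Lemma diam_pow_le s U d : (0 <= s)%R -> diam U <= d -> diam_pow s U <= d `^ s.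
Proof.
move=> s0 Ud; rewrite /diam_pow; case: ifP => _; first exact: poweR_ge0.
by apply: le_poweR => //; exact: diam_ge0.
Qed.

(** The condition on emptiness matters at exponent 0, where a point costs 1 and the empty set 0
    although both have diameter 0. *)
Lemma diam_pow_dilate s c U V : (0 <= s)%R -> (0 <= c)%R ->
  (V = set0 -> U = set0) -> diam U <= c%:E * diam V ->
  diam_pow s U <= (c `^ s)%:E * diam_pow s V.
Proof.
move=> s0 c0 VU UV; have [V0|/set0P V0] := eqVneq V set0.
  by rewrite (VU V0) diam_pow_set0 mule_ge0 ?lee_fin ?powR_ge0 ?diam_pow_ge0.
by rewrite (diam_pow_neq0 _ V0) -poweR_EFin -poweRM ?diam_ge0 ?lee_fin//; exact: diam_pow_le.
Qed.

Lemma diam_pow_subset s U V : (0 <= s)%R -> U `<=` V -> diam_pow s U <= diam_pow s V.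
Proof.
move=> s0 UV; have := @diam_pow_dilate s 1%R U V s0 ler01.
rewrite powR1 !mul1e; apply; last exact: diam_subset.
by move=> V0; rewrite V0 subset0 in UV.
Qed.

Lemma hausdorff_pre_le_cover s d X (U : nat -> set 'rV[R]_n) :
  X `<=` \bigcup_k U k -> (forall k, diam (U k) <= d) ->
  hausdorff_pre s d X <= \sum_(0 <= k <oo) diam_pow s (U k).
Proof. by move=> XU Ud; apply: ereal_inf_lbound; exists U. Qed.

Lemma hausdorff_pre_ge0 s d X : 0 <= hausdorff_pre s d X.
Proof.
apply: le_ereal_inf_tmp => _ [U _ <-]; apply: nneseries_ge0 => k _ _.
exact: diam_pow_ge0.
Qed.

Lemma hausdorff_pre_delta s d1 d2 X : d1 <= d2 ->
  hausdorff_pre s d2 X <= hausdorff_pre s d1 X.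
Proof.
move=> d12; apply: ereal_inf_le_tmp => _ [U [XU Ud] <-]; exists U => //; split=> // k.
exact: le_trans (Ud k) d12.
Qed.

Lemma hausdorff_pre_subset s d X Y : X `<=` Y ->
  hausdorff_pre s d X <= hausdorff_pre s d Y.
Proof.
move=> XY; apply: ereal_inf_le_tmp => _ [U [YU Ud] <-]; exists U => //; split=> //.
exact: subset_trans YU.
Qed.

Lemma hausdorff_pre_le_diam_pow s d X : diam X <= d ->
  hausdorff_pre s d X <= diam_pow s X.
Proof.
move=> Xd; pose U k := if k == 0%N then X else set0.
apply: (@le_trans _ _ (\sum_(0 <= k <oo) diam_pow s (U k))).
  apply: hausdorff_pre_le_cover => [x Xx|[|k]]; first by exists 0%N.
    exact: Xd.
  by rewrite /U/= diam_set0 (le_trans (diam_ge0 X)).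
rewrite (nneseries_split 0 1)//; last by move=> k _; exact: diam_pow_ge0.
rewrite big_nat1 eseries0 ?adde0// => -[|k]// _ _.
by rewrite /U/= diam_pow_set0.
Qed.

(** Intersecting the covering sets with [X] does not raise their cost and makes them small
    enough. *)
Lemma hausdorff_pre_le_content s d X : (0 <= s)%R -> diam X <= d ->
  hausdorff_pre s d X <= hausdorff_content s X.
Proof.
move=> s0 Xd; apply: le_ereal_inf_tmp => _ [U [XU _] <-].
apply: (@le_trans _ _ (\sum_(0 <= k <oo) diam_pow s (U k `&` X))).
  apply: hausdorff_pre_le_cover => [x Xx|k].
    by have [k _ Ukx] := XU x Xx; exists k.
  exact: le_trans (diam_subset (@subIsetr _ _ _)) Xd.
by apply: lee_nneseries => k *; [exact: diam_pow_ge0|exact: diam_pow_subset].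
Qed.

Lemma hausdorff_pre_bigcup s d (X : nat -> set 'rV[R]_n) :
  hausdorff_pre s d (\bigcup_m X m) <= \sum_(0 <= m <oo) hausdorff_pre s d (X m).
Proof.
(* Near-optimal covers are available only for finite infima, hence the separate case. *)
have [[i ioo]|] := pselect (exists i, hausdorff_pre s d (X i) = +oo).
  by rewrite (nneseries_pinfty _ _ ioo) ?leey// => *; exact: hausdorff_pre_ge0.
rewrite -forallNE => Xoo; apply/lee_addgt0Pr => e e0.
apply: le_trans (epsilon_trick _ _ (ltW e0)); last first.
  by move=> m; exact: hausdorff_pre_ge0.
have adh m : exists U : nat -> set 'rV[R]_n,
    [/\ X m `<=` \bigcup_k U k, forall k, diam (U k) <= d &
     \sum_(0 <= k <oo) diam_pow s (U k) <=
       hausdorff_pre s d (X m) + (e / (2 ^ m.+1)%:R)%:E].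
  have fin : hausdorff_pre s d (X m) \is a fin_num.
    by rewrite ge0_fin_numE ?hausdorff_pre_ge0// ltey; exact/eqP/Xoo.
  have em : (0 < e / (2 ^ m.+1)%:R)%R by rewrite divr_gt0// ltr0n expn_gt0.
  have [_ [U [XU Ud] <-] le] := lb_ereal_inf_adherent em fin.
  by exists U; split=> //; exact: ltW.
have [G PG] := choice adh.
apply: (@le_trans _ _ (\sum_(0 <= m <oo) \sum_(0 <= k <oo) diam_pow s (G m k))); last first.
  apply: lee_nneseries => m *; last by have [] := PG m.
  by apply: nneseries_ge0 => *; exact: diam_pow_ge0.
have dp0 m k : 0 <= diam_pow s (G m k) by exact: diam_pow_ge0.
rewrite (eq_eseriesr (fun m _ => nneseries_esumT (dp0 m))).
rewrite nneseries_esumT; last by move=> m; exact: esum_ge0.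
rewrite esum_esum//.
have /card_esym/ppcard_eqP[f] := card_nat2.
have -> : [set: nat] `*`` (fun=> [set: nat]) = [set: nat * nat].
  by apply/seteqP; split.
rewrite (reindex_esum [set: nat] _ f); last exact: bij.
rewrite -nneseries_esumT//; apply: hausdorff_pre_le_cover => [x [m _ Xmx]|k].
  have [XG _ _] := PG m; have [k _ Gx] := XG x Xmx.
  by exists (f^-1%FUN (m, k)) => //=; rewrite invK ?inE.
by have [_ + _] := PG (f k).1; exact.
Qed.

(** Working with a map on sets lets [phi] be the image or the preimage under a similarity; the
    preimage gives the lower bound without constructing an inverse. *)
Lemma hausdorff_pre_transfer s d c (phi : set 'rV[R]_n -> set 'rV[R]_n) X Y :
  (0 <= s)%R -> (0 < c)%R ->
  (forall U, diam (phi U) <= c%:E * diam U) -> phi set0 = set0 ->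
  (forall U : nat -> set 'rV[R]_n, X `<=` \bigcup_k U k -> Y `<=` \bigcup_k phi (U k)) ->
  hausdorff_pre s (c%:E * d) Y <= (c `^ s)%:E * hausdorff_pre s d X.
Proof.
move=> s0 c0 phic phi0 XY; rewrite -lee_pdivrMl ?powR_gt0//.
apply: le_ereal_inf_tmp => _ [U [XU Ud] <-].
rewrite lee_pdivrMl ?powR_gt0// -nneseriesZl; last by move=> *; exact: diam_pow_ge0.
apply: (@le_trans _ _ (\sum_(0 <= k <oo) diam_pow s (phi (U k)))).
  apply: hausdorff_pre_le_cover; first exact: XY.
  by move=> k; apply: le_trans (phic _) _; rewrite lee_pmul2l ?lte_fin.
apply: lee_nneseries => k *; first exact: diam_pow_ge0.
by apply: diam_pow_dilate => //; [exact: ltW|move=> ->].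
Qed.

Section Similarity.
Variables (f : 'rV[R]_n -> 'rV[R]_n) (r : R).
Hypotheses (r0 : (0 < r)%R) (fr : forall x y, edist (f x) (f y) = (r * edist x y)%R).

Lemma hausdorff_pre_image_le s d X : (0 <= s)%R ->
  hausdorff_pre s (r%:E * d) (f @` X) <= (r `^ s)%:E * hausdorff_pre s d X.
Proof.
move=> s0; apply: (@hausdorff_pre_transfer _ _ _ (fun U => f @` U)) => //.
- move=> U; apply: diam_le => [|_ _ [x Ux <-] [y Uy <-]].
    by rewrite mule_ge0 ?diam_ge0// lee_fin ltW.
  by rewrite fr EFinM lee_pmul2l ?lte_fin//; exact: edist_le_diam.
- exact: image_set0.
- move=> U XU _ [x Xx <-]; have [k _ Ukx] := XU x Xx.
  by exists k => //; exists x.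
Qed.

Lemma hausdorff_pre_image_ge s d X : (0 <= s)%R ->
  (r `^ s)%:E * hausdorff_pre s d X <= hausdorff_pre s (r%:E * d) (f @` X).
Proof.
move=> s0.
have -> : hausdorff_pre s d X = hausdorff_pre s (r^-1%:E * (r%:E * d)) X.
  by rewrite muleA -EFinM mulVf ?gt_eqF// mul1e.
rewrite -lee_pdivlMl ?powR_gt0//.
have <- : (r^-1 `^ s = (r `^ s)^-1)%R.
  by rewrite -[in RHS]powR_inv1 ?powR_ge0// powRAC powR_inv1 ?ltW.
apply: (@hausdorff_pre_transfer _ _ _ (fun U => f @^-1` U)) => //.
- by rewrite invr_gt0.
- move=> U; apply: diam_le => [|x y Ux Uy].
    by rewrite mule_ge0 ?diam_ge0// lee_fin invr_ge0 ltW.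
  by rewrite lee_pdivlMl// -EFinM -fr; exact: edist_le_diam.
- move=> U XU x Xx; have [k _ Ukx] := XU (f x) (imageP f Xx).
  by exists k.
Qed.

End Similarity.

(** The premeasure is monotone in delta, so its right limit at 0 is a supremum. *)
Lemma hausdorff_measureE s X : hausdorff_measure s X =
  ereal_sup [set hausdorff_pre s d%:E X | d in [set d | (0 < d)%R]].
Proof.
have -> : [set d : R | (0 < d)%R] = [set` `]0%R, +oo[].
  by apply/seteqP; split => d /=; rewrite in_itv/= andbT.
apply/cvg_lim => //; apply: (nonincreasing_at_right_cvge (BInfty R false)) => //.
by move=> d1 d2 _ _ d12; apply: hausdorff_pre_delta; rewrite lee_fin.
Qed.

(** The content never exceeds the measure, so only the reverse inequality, scale by scale, has to be
    shown. *)
Lemma content_eq_measureP s X : hausdorff_content s X = hausdorff_measure s X <->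
  forall d : R, (0 < d)%R -> hausdorff_pre s d%:E X <= hausdorff_content s X.
Proof.
rewrite hausdorff_measureE; split=> [-> d d0|h].
  by apply: ereal_sup_ubound; exists d.
apply/le_anti/andP; split; last by apply: ge_ereal_sup => _ [d d0 <-]; exact: h.
apply: (@le_trans _ _ (hausdorff_pre s 1%:E X)); last first.
  by apply: ereal_sup_ubound; exists 1%R => /=.
by apply: hausdorff_pre_delta; exact: leey.
Qed.

End HausdorffPre.

Section SimilarityInvariance.
Variables (R : realType) (n : nat) (f : 'rV[R]_n -> 'rV[R]_n) (r s : R).
Hypotheses (r0 : 0 < r) (s0 : 0 <= s).
Hypothesis fr : forall x y, edist (f x) (f y) = r * edist x y.

(** Both sides scale by r^s. Longer words use the passage from [X] to its image, unions of
    successors the passage back. *)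
Lemma content_eq_measure_image X :
  hausdorff_content s (f @` X) = hausdorff_measure s (f @` X) <->
  hausdorff_content s X = hausdorff_measure s X.
Proof.
have rs0 : 0 < r `^ s by exact: powR_gt0.
have roo : (r%:E * +oo = +oo :> \bar R)%E by rewrite gt0_muley ?lte_fin.
rewrite !content_eq_measureP; split=> h d d0.
  have := h (r * d) (mulr_gt0 r0 d0); rewrite EFinM /hausdorff_content => hd.
  rewrite -(@lee_pmul2l _ (r `^ s)%:E) ?lte_fin//.
  apply: le_trans (hausdorff_pre_image_ge r0 fr _ _ s0) _; apply: le_trans hd _.
  by rewrite -{1}roo; exact: hausdorff_pre_image_le.
have -> : d = r * (d / r) by rewrite mulrC divfK ?gt_eqF.
rewrite EFinM; apply: le_trans (hausdorff_pre_image_le r0 fr _ _ s0) _.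
apply: (@le_trans _ _ ((r `^ s)%:E * hausdorff_content s X)%E).
  by rewrite lee_pmul2l ?lte_fin//; apply: h; exact: divr_gt0.
by rewrite /hausdorff_content -[in leRHS]roo; exact: hausdorff_pre_image_ge.
Qed.

End SimilarityInvariance.

Lemma content_eq_measure_set0 (R : realType) (n : nat) (s : R) :
  hausdorff_content s (@set0 'rV[R]_n) = hausdorff_measure s (@set0 'rV[R]_n).
Proof.
apply/content_eq_measureP => d d0; apply: le_trans (hausdorff_pre_ge0 _ _ _).
by rewrite -(@diam_pow_set0 R n s) hausdorff_pre_le_diam_pow// diam_set0 lee_fin ltW.
Qed.

(** * Disjoint copies of a compact set *)

Lemma uniform_pos (R : realType) (N : nat) (P : nat -> R -> Prop) :
  (forall k e e', P k e -> 0 < e' <= e -> P k e') ->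
  (forall k, (k < N)%N -> exists2 e, 0 < e & P k e) ->
  exists2 e, 0 < e & forall k, (k < N)%N -> P k e.
Proof.
move=> Pdown; elim: N => [_|N IH PN]; first by exists 1.
have [|e e0 Pe] := IH; first by move=> k kN; apply: PN; exact: ltnW.
have [e' e'0 Pe'] := PN N (ltnSn N).
have m0 : 0 < Num.min e e' by rewrite lt_min e0.
exists (Num.min e e') => // k; rewrite ltnS leq_eqVlt => /orP[/eqP->|kN].
  by apply: Pdown Pe' _; rewrite m0 ge_min lexx orbT.
by apply: Pdown (Pe _ kN) _; rewrite m0 ge_min lexx.
Qed.

Lemma exists_natSinv_lt (R : realType) (e : R) : 0 < e ->
  exists N : nat, forall m : nat, (N <= m)%N -> m.+1%:R^-1 < e.
Proof.
move=> e0; have [N _ hN] := near_infty_natSinv_lt (PosNum e0).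
by exists N => m Nm; exact: hN.
Qed.

(** Stated through cluster points in [edist]: this avoids extracting subsequences and comparing with
    the sup-norm topology. *)
Definition seq_compact (R : realType) (n : nat) (X : set 'rV[R]_n) : Prop :=
  forall u : nat -> 'rV[R]_n, (forall m, X (u m)) -> exists2 x, X x &
    forall e, 0 < e -> forall N : nat, exists2 m : nat, (N <= m)%N & edist (u m) x < e.

Section SeqCompact.
Variables (R : realType) (n : nat).
Implicit Types (x y : 'rV[R]_n) (X Y : set 'rV[R]_n).

Lemma seq_compact_image X (f : 'rV[R]_n -> 'rV[R]_n) (r : R) :
  (forall x y, edist (f x) (f y) = r * edist x y) -> 0 < r ->
  seq_compact X -> seq_compact (f @` X).
Proof.
move=> fr r0 Xc u uX.
have /choice[v vP] m : exists x, X x /\ f x = u m by have [x Xx <-] := uX m; exists x.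
have [x Xx vx] := Xc v (fun m => (vP m).1).
exists (f x); first exact: imageP.
move=> e e0 N; have [|m Nm vmx] := vx (e / r) _ N; first exact: divr_gt0.
by exists m => //; rewrite -(vP m).2 fr mulrC -ltr_pdivlMr.
Qed.

Lemma seq_compact_closed X x : seq_compact X ->
  (forall e, 0 < e -> exists2 y, X y & edist y x < e) -> X x.
Proof.
move=> Xc Xx.
have /choice[u uP] (m : nat) : exists y, X y /\ edist y x < m.+1%:R^-1.
  by have [|y Xy yx] := Xx m.+1%:R^-1; [rewrite invr_gt0|exists y].
have [y Xy uy] := Xc u (fun m => (uP m).1).
suff -> : x = y by [].
apply: edist_small_eq => e e0.
have e20 : 0 < e / 2 by rewrite divr_gt0.
have [N NP] := exists_natSinv_lt e20.
have [m Nm umy] := uy _ e20 N.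
apply: le_lt_trans (edist_triangle (u m) x y) _.
rewrite (splitr e) ltrD// edistC.
by apply: lt_trans (uP m).2 _; exact: NP.
Qed.

(** Otherwise points of [X] come arbitrarily close to [Y], and a cluster point of them lies in both
    sets. *)
Lemma seq_compact_disjoint_dist X Y : seq_compact X -> seq_compact Y ->
  X `&` Y = set0 ->
  exists2 d, 0 < d & forall x y, X x -> Y y -> d <= edist x y.
Proof.
move=> Xc Yc XY; apply: contrapT => h.
have hd d : 0 < d -> exists x, X x /\ exists2 y, Y y & edist x y < d.
  move=> d0; apply: contrapT => hx; apply: h; exists d => // x y Xx Yy.
  by rewrite leNgt; apply/negP => xyd; apply: hx; exists x; split => //; exists y.
have /choice[u uP] (m : nat) := hd m.+1%:R^-1 (eqbRL (invr_gt0 _) (ltr0Sn _ _)).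
have [x Xx ux] := Xc u (fun m => (uP m).1).
suff Yx : Y x by rewrite -[False]/(set0 x) -XY.
apply: seq_compact_closed => // e e0.
have e20 : 0 < e / 2 by rewrite divr_gt0.
have [N NP] := exists_natSinv_lt e20.
have [m Nm umx] := ux _ e20 N.
have [_ [y Yy uy]] := uP m; exists y => //.
apply: le_lt_trans (edist_triangle (u m) y x) _.
rewrite (splitr e) ltrD// edistC.
by apply: lt_trans uy _; exact: NP.
Qed.

End SeqCompact.

Lemma sume_le_disjoint (R : realType) (N : nat) (P : nat -> bool) (Q : nat -> bool)
    (a : \bar R) : (0 <= a)%E ->
  (forall k l, (k < N)%N -> (l < N)%N -> P k -> P l -> Q k -> Q l -> k = l) ->
  (\sum_(0 <= k < N | P k) (if Q k then a else 0) <= a)%E.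
Proof.
move=> a0; elim: N => [_|N IH PQ]; first by rewrite big_geq.
rewrite big_mkcond big_nat_recr//= -big_mkcond/=.
have [/andP[PN QN]|PQN] := boolP (P N && Q N).
  rewrite PN QN big_nat_cond big1 ?add0e// => k /andP[/= kN Pk].
  case: ifP => // Qk.
  by have := PQ k N (ltnW kN) (ltnSn N) Pk PN Qk QN => kE; rewrite kE ltnn in kN.
have -> : (if P N then if Q N then a else 0 else 0)%E = 0%E :> \bar R.
  by case: (P N) PQN => //= /negPf->.
rewrite adde0; apply: IH => k l kN lN; apply: PQ; exact: ltnW.
Qed.

(** * Positive content from finitely many disjoint copies *)

Section SubIFS.
Variables (R : realType) (n : nat) (K : set 'rV[R]_n) (N : nat) (E : pred nat).
Variables (f : nat -> 'rV[R]_n -> 'rV[R]_n) (r : nat -> R).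
Hypotheses (K0 : K !=set0) (Kc : seq_compact K).
Hypothesis r01 : forall k, E k -> 0 < r k < 1.
Hypothesis fr : forall k, E k -> forall x y, edist (f k x) (f k y) = r k * edist x y.
Hypothesis fK : forall k, E k -> f k @` K `<=` K.
Hypothesis Edisj : forall k l, E k -> E l -> k <> l -> (f k @` K) `&` (f l @` K) = set0.

Lemma subifs_gap : exists2 d, 0 < d & forall k l, (k < N)%N -> (l < N)%N ->
  E k -> E l -> k <> l -> forall x y, K x -> K y -> d <= edist (f k x) (f l y).
Proof.
pose P1 k l d := E k -> E l -> k <> l ->
  forall x y, K x -> K y -> d <= edist (f k x) (f l y).
suff [d d0 dP] : exists2 d, 0 < d &
    forall k, (k < N)%N -> forall l, (l < N)%N -> P1 k l d.
  by exists d => // k l kN lN; exact: dP.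
apply: (@uniform_pos _ _ (fun k d => forall l, (l < N)%N -> P1 k l d)).
  move=> k e e' Pe /andP[_ e'e] l lN Ek El kl x y Kx Ky.
  exact: le_trans e'e (Pe _ lN Ek El kl _ _ Kx Ky).
move=> k kN; apply: (@uniform_pos _ _ (P1 k)).
  move=> l e e' Pe /andP[_ e'e] Ek El kl x y Kx Ky.
  exact: le_trans e'e (Pe Ek El kl _ _ Kx Ky).
move=> l lN; have [[Ek [El kl]]|h] := pselect (E k /\ E l /\ k <> l); last first.
  by exists 1 => // Ek El kl; case: h.
have /andP[rk0 _] := r01 Ek; have /andP[rl0 _] := r01 El.
have [d d0 dP] := seq_compact_disjoint_dist (seq_compact_image (fr Ek) rk0 Kc)
  (seq_compact_image (fr El) rl0 Kc) (Edisj Ek El kl).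
by exists d => // _ _ _ x y Kx Ky; apply: dP; exact: imageP.
Qed.

Section Cover.
Variables (t d : R) (U : nat -> set 'rV[R]_n) (a : nat -> \bar R).
Hypothesis t0 : 0 < t.
Hypothesis rt1 : 1 <= \sum_(0 <= k < N | E k) r k `^ t.
Hypothesis d0 : 0 < d.
Hypothesis gap : forall k l, (k < N)%N -> (l < N)%N ->
  E k -> E l -> k <> l -> forall x y, K x -> K y -> d <= edist (f k x) (f l y).
Hypothesis a0 : forall k, (0 < a k)%E.
Hypothesis Ua : forall k, (diam_pow t (U k) <= a k)%E.

Let meets (X : set 'rV[R]_n) k : bool := `[< U k `&` X !=set0 >].
(** Weights replace the costs of the covering sets because a single point has cost 0 when t > 0;
    strict positivity of [a] is what ends the descent. *)
Let mass X : \bar R := (\sum_(0 <= k <oo) (if meets X k then a k else 0))%E.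

Let term_ge0 X k : (0 <= if meets X k then a k else 0)%E.
Proof. by case: ifP => // _; exact: ltW. Qed.

Let a_le_mass X k : meets X k -> (a k <= mass X)%E.
Proof.
move=> Xk; apply: (@le_trans _ _ (\sum_(0 <= j < k.+1) (if meets X j then a j else 0))%E).
  by rewrite big_nat_recr//= Xk leeDr// sume_ge0.
by apply: nneseries_lim_ge => *; exact: term_ge0.
Qed.

(** The threshold is the cost of a set of diameter rho * d, the gap between distinct subcopies of
    the copy [g]. *)
Let light (g : 'rV[R]_n -> 'rV[R]_n) (rho : R) := [/\ 0 < rho,
  forall x y, edist (g x) (g y) = rho * edist x y &
  (mass (g @` K) < ((rho * d) `^ t)%:E)%E].

(* No covering set meeting a light copy is large enough to meet two of its
   subcopies, so if all subcopies were heavy, their masses would add up to at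
   least [(rho * d) `^ t].  Iterating, a light [K] contains a point that no
   [U k] can contain, since [a k] would have to be arbitrarily small. *)
Lemma light_step g rho : light g rho ->
  exists l, [/\ (l < N)%N, E l & light (g \o f l) (rho * r l)].
Proof.
move=> [rho0 gr gm]; apply: contrapT => h.
have heavy l : (l < N)%N -> E l ->
    (((rho * d) `^ t * r l `^ t)%:E <= mass ((g \o f l) @` K))%E.
  move=> lN El; rewrite leNgt; apply/negP => lm; apply: h; exists l.
  have /andP[rl0 _] := r01 El; split=> //; split.
  - exact: mulr_gt0.
  - by move=> x y /=; rewrite gr fr// mulrA.
  - by rewrite mulrAC powRM ?mulr_ge0// ltW.
have := gm; apply/negP; rewrite -leNgt.
apply: (@le_trans _ _ (\sum_(0 <= l < N | E l) mass ((g \o f l) @` K))%E).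
  apply: (@le_trans _ _ (\sum_(0 <= l < N | E l) ((rho * d) `^ t * r l `^ t)%:E)%E).
    rewrite sumEFin lee_fin -mulr_sumr ler_peMr ?powR_ge0//.
  rewrite big_nat_cond [leRHS]big_nat_cond; apply: lee_sum => l /andP[/= lN El].
  exact: heavy.
(* After exchanging the sums it suffices that each covering set is counted for at most one
   subcopy. *)
rewrite -nneseries_sum; last by move=> *; exact: term_ge0.
apply: lee_nneseries => k *; first by apply: sume_ge0 => *; exact: term_ge0.
have sub l : E l -> (g \o f l) @` K `<=` g @` K.
  by move=> El _ [x Kx <-]; exists (f l x) => //; apply: (fK El); exact: imageP.
case: ifPn => [gk|gk]; last first.
  rewrite big1// => l El; case: ifPn => // /asboolP[x [Ux /(sub _ El) gx]].
  by move/negP: gk; case; apply/asboolP; exists x.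
apply: sume_le_disjoint; first exact: ltW.
move=> l l' lN l'N El El' /asboolP[_x [Ux [x Kx xE]]] /asboolP[_y [Uy [y Ky yE]]].
subst _x _y.
apply: contrapT => ll'.
have := a_le_mass gk; apply/negP; rewrite -ltNge; apply: lt_le_trans (Ua k).
apply: lt_le_trans gm _.
rewrite diam_pow_neq0; last by exists ((g \o f l) x).
rewrite -poweR_EFin; apply: le_poweR.
- exact: ltW.
- by rewrite lee_fin mulr_ge0 ?ltW.
apply: le_trans (edist_le_diam Ux Uy); rewrite lee_fin/= gr ler_pM2l//.
exact: gap.
Qed.

Lemma heavy_cover : K `<=` \bigcup_k U k ->
  ((d `^ t)%:E <= \sum_(0 <= k <oo) a k)%E.
Proof.
move=> KU; rewrite leNgt; apply/negP => aU.
have light0 : light id 1.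
  split => //; first by move=> x y; rewrite mul1r.
  rewrite mul1r; apply: le_lt_trans aU; apply: lee_nneseries => k * //.
  by case: ifP => // _; exact: ltW.
pose st := {gr : ('rV[R]_n -> 'rV[R]_n) * R | light gr.1 gr.2}.
pose next (p q : st) := exists l, [/\ (l < N)%N, E l,
  (sval q).1 = (sval p).1 \o f l & (sval q).2 = (sval p).2 * r l].
have step (p : st) : {q | next p q}.
  apply: cid; case: p => -[g rho] /= lp; have [l [lN El lq]] := light_step lp.
  by exists (exist _ (g \o f l, rho * r l) lq); exists l; split.
have [w [w0 wS]] := dependent_choice step (exist _ (id, 1) light0).
pose g m := (sval (w m)).1; pose rho m := (sval (w m)).2.
have wl m : light (g m) (rho m) by exact: (svalP (w m)).
have nest m p : (m <= p)%N -> g p @` K `<=` g m @` K.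
  elim: p => [|p IH]; first by rewrite leqn0 => /eqP->.
  rewrite leq_eqVlt => /orP[/eqP->//|mp].
  apply: subset_trans (IH mp); have [l [_ El gp _]] := wS p.
  rewrite /g gp => _ [x Kx <-]; exists (f l x) => //.
  by apply: (fK El); exact: imageP.
(* A uniform bound on the finitely many ratios makes the nested copies shrink geometrically; the
   maximum with 1/2 keeps [q] positive. *)
have [q q01 qP] : exists2 q, 0 < q < 1 & forall l, (l < N)%N -> E l -> r l <= q.
  have [l e e' Pe /andP[_ e'e] El|l lN|e e0 eP] := @uniform_pos R N
      (fun l e => E l -> r l <= 1 - e).
  - by apply: le_trans (Pe El) _; rewrite lerB.
  - have [El|] := boolP (E l); last by exists 1.
    have /andP[_ rl1] := r01 El.
    by exists (1 - r l) => [|_]; rewrite ?subr_gt0 ?subKr.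
  - exists (Num.max (1 - e) 2^-1) => [|l lN El].
      by rewrite lt_max gt_max invr_gt0 ltr0n orbT invf_lt1 ?ltr1n// ltrBlDr ltrDl e0.
    by rewrite le_max eP.
have rhoq m : rho m <= q ^+ m.
  elim: m => [|m IH]; first by rewrite /rho w0 expr0.
  have [l [lN El _ gp]] := wS m.
  have [rho0 _ _] := wl m.
  rewrite /rho gp exprSr ler_pM ?qP//; first exact: ltW.
  by have /andP[/ltW] := r01 El.
have [x0 Kx0] := K0.
have gK m : g m @` K `<=` K.
  by apply: subset_trans (nest 0%N m (leq0n m)) _; rewrite /g w0 image_id.
(* The copies are nested and closed, so this cluster point lies in all of them. *)
have [x Kx gx] := Kc (u := fun m => g m x0) (fun m => gK m _ (imageP _ Kx0)).
have gmx m : (g m @` K) x.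
  have [rho0 gr _] := wl m.
  apply: (seq_compact_closed (seq_compact_image gr rho0 Kc)) => e e0.
  have [p mp px] := gx _ e0 m; exists (g p x0) => //.
  by apply: (nest _ _ mp); exact: imageP.
have [k _ Ukx] := KU x Kx.
have ak m : (a k < ((q `^ t) ^+ m * d `^ t)%:E)%E.
  have [rho0 gr gm] := wl m.
  apply: le_lt_trans (a_le_mass (X := g m @` K) (k := k) _) _.
    by apply/asboolP; exists x; split => //; exact: gmx.
  apply: lt_le_trans gm _; rewrite lee_fin.
  rewrite powRM ?(ltW rho0) ?(ltW d0)// ler_wpM2r ?powR_ge0//.
  rewrite -powR_mulrn ?powR_ge0// powRAC powR_mulrn; last by have /andP[/ltW] := q01.
  by apply: ge0_ler_powR; rewrite ?nnegrE ?exprn_ge0 ?(ltW t0) ?(ltW rho0)//;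
    have /andP[/ltW] := q01.
have [q0 q1] := andP q01.
have qt1 : q `^ t < 1.
  have t1 : 1 `^ t = 1 :> R by rewrite powR1.
  by rewrite -t1; apply: gt0_ltr_powR; rewrite ?nnegrE ?(ltW q0).
have [b b0 bk] : exists2 b, 0 < b & (b%:E <= a k)%E.
  have := a0 k; case: (a k) => [b|_|//]; first by rewrite lte_fin; exists b.
  by exists 1; rewrite ?leey.
have c0 : 0 < d `^ t by exact: powR_gt0.
have := @cvg_expr R (q `^ t); rewrite ger0_norm ?powR_ge0// => /(_ qt1).
move=> /cvgrPdist_lt /(_ (b / d `^ t)) [|m _ /(_ m (leqnn m))] /=.
  exact: divr_gt0.
rewrite sub0r normrN ger0_norm ?exprn_ge0 ?powR_ge0// ltr_pdivlMr// => qb.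
by have := lt_trans (le_lt_trans bk (ak m)) (qb : (_%:E < _%:E)%E); rewrite ltxx.
Qed.

End Cover.

(** Adding e / 2^(k+1) to the cost of the k-th covering set gives positive weights with total excess
    e; the resulting bound d^t does not depend on the cover. *)
Lemma subifs_content_gt0 (t : R) : 0 < t ->
  1 <= \sum_(0 <= k < N | E k) r k `^ t -> (0 < hausdorff_content t K)%E.
Proof.
move=> t0 rt1; have [d d0 gap] := subifs_gap.
apply: (@lt_le_trans _ _ ((d `^ t)%:E)); first by rewrite lte_fin powR_gt0.
apply: le_ereal_inf_tmp => _ [U [KU _] <-].
apply/lee_addgt0Pr => e e0.
apply: le_trans (epsilon_trick _ _ (ltW e0)); last by move=> *; exact: diam_pow_ge0.
have e2 k : (0 < (e / (2 ^ k.+1)%:R)%:E)%E.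
  by rewrite lte_fin divr_gt0// ltr0n expn_gt0.
apply: (heavy_cover t0 rt1 d0 gap _ _ KU) => k.
- by rewrite (lt_le_trans (e2 k))// leeDr// diam_pow_ge0.
- by rewrite leeDl// ltW.
Qed.

End SubIFS.

(** * Ratios of disjoint copies at the exponent s *)

Section DisjointCopies.
Variables (R : realType) (n : nat) (K : set 'rV[R]_n) (E : pred nat).
Variables (f : nat -> 'rV[R]_n -> 'rV[R]_n) (r : nat -> R) (s : R).
Hypotheses (K0 : K !=set0) (Kc : seq_compact K).
Hypothesis r01 : forall k, E k -> 0 < r k < 1.
Hypothesis fr : forall k, E k -> forall x y, edist (f k x) (f k y) = r k * edist x y.
Hypothesis fK : forall k, E k -> f k @` K `<=` K.
Hypothesis Edisj : forall k l, E k -> E l -> k <> l -> (f k @` K) `&` (f l @` K) = set0.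
Hypothesis s_dim : forall t, s < t -> exists t',
  [/\ 0 <= t', t' < t & hausdorff_content t' K = 0%E].

(** Excludes exponent 0, which [subifs_content_gt0] does not cover. *)
Lemma content0_ge1 : (1 <= hausdorff_content 0%R K)%E.
Proof.
have [x Kx] := K0; apply: le_ereal_inf_tmp => _ [U [KU _] <-].
have [k _ Ukx] := KU x Kx.
have -> : 1%E = diam_pow 0 (U k) :> \bar R.
  by rewrite diam_pow_neq0 ?poweRe0//; exists x.
apply: (@le_trans _ _ (\sum_(0 <= j < k.+1) diam_pow 0 (U j))%E).
  by rewrite big_nat_recr//= leeDr// sume_ge0// => *; exact: diam_pow_ge0.
by apply: nneseries_lim_ge => *; exact: diam_pow_ge0.
Qed.

Lemma sum_ratio_le1 N : \sum_(0 <= k < N | E k) r k `^ s <= 1.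
Proof.
rewrite leNgt; apply/negP => X1.
set X := \sum_(_ <= _ < _ | _) _ in X1.
(* By convexity of the exponential, the sum of ratios at exponent s + h is at least its tangent X -
   h * Y; [h] is chosen to keep this at least 1, and the 1 in its denominator allows Y = 0. *)
pose Y := \sum_(0 <= k < N | E k) r k `^ s * - ln (r k).
have Y0 : 0 <= Y.
  apply: sumr_ge0 => k Ek; rewrite mulr_ge0 ?powR_ge0// oppr_ge0 ln_le0//.
  by have /andP[_ /ltW] := r01 Ek.
pose h := (X - 1) / (1 + Y).
have h0 : 0 < h by rewrite divr_gt0 ?subr_gt0// ltr_pwDl.
have [t' [t'0 t't Kt']] : exists t', [/\ 0 <= t', t' < s + h & hausdorff_content t' K = 0%E].
  by apply: s_dim; rewrite ltrDl.
have rt k : E k -> r k `^ s - h * (r k `^ s * - ln (r k)) <= r k `^ t'.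
  move=> Ek; have /andP[rk0 rk1] := r01 Ek.
  have lnr : ln (r k) <= 0 by rewrite ln_le0 ?ltW.
  apply: (@le_trans _ _ (r k `^ (s + h))); last first.
    rewrite /powR gt_eqF// ler_expR; nra.
  rewrite powRD ?(gt_eqF rk0) ?implybT//.
  have -> : r k `^ s - h * (r k `^ s * - ln (r k)) = r k `^ s * (1 + h * ln (r k)) by ring.
  rewrite ler_wpM2l ?powR_ge0// /powR gt_eqF//; exact: expR_ge1Dx.
have rt1 : 1 <= \sum_(0 <= k < N | E k) r k `^ t'.
  apply: (@le_trans _ _ (X - h * Y)).
    suff : h * Y <= X - 1 by lra.
    by rewrite /h mulrAC ler_pdivrMr ?ltr_pwDl// ler_wpM2l ?subr_ge0 ?lerDr// ltW.
  by rewrite /X /Y mulr_sumr -sumrB; apply: ler_sum => ? ?; exact: rt.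
have [t'p|t'n] := ltP 0 t'; last first.
  have t'E : t' = 0 by apply/le_anti; rewrite t'n.
  by have := content0_ge1; rewrite -t'E Kt' lee_fin ler10.
by have := subifs_content_gt0 K0 Kc r01 fr fK Edisj t'p rt1; rewrite Kt' ltxx.
Qed.

End DisjointCopies.

(** * Vitali covering by copies *)

(* Vitali's covering lemma: the Zorn order only allows disjoint subfamilies in
   which every member met by the family is dominated by one of its elements. *)
Lemma ex_vitali_subfamily (R : realType) (T I : Type) (B : I -> set T)
    (r : I -> R) (L : set I) (b : R) :
  (forall i, L i -> B i !=set0) -> (forall i, L i -> 0 < r i <= b) ->
  exists E : set I, [/\ E `<=` L,
    forall i j, E i -> E j -> i <> j -> B i `&` B j = set0 &
    forall i, L i -> exists j, [/\ E j, B i `&` B j !=set0 & r i <= 2 * r j]].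
Proof.
move=> B0 rb.
pose dom (E : set I) := forall i j, L i -> E j -> B i `&` B j !=set0 ->
  exists k, [/\ E k, B i `&` B k !=set0 & r i <= 2 * r k].
pose P (E : set I) := [/\ E `<=` L,
    forall i j, E i -> E j -> i <> j -> B i `&` B j = set0 & dom E].
have [|E [[EL Edisj Edom] Emax]] := @Zorn_bigcup I P.
  move=> F FP Ftot; split.
  - by apply: bigcup_sub => X /FP[].
  - move=> i j [X FX Xi] [Y FY Yj] ij.
    have [XY|YX] := Ftot _ _ FX FY.
      by have [_ + _] := FP _ FY; apply => //; exact: XY.
    by have [_ + _] := FP _ FX; apply => //; exact: YX.
  - move=> i j Li [X FX Xj] ij; have [_ _ /(_ i j Li Xj ij)[k [Xk ik rk]]] := FP _ FX.
    by exists k; split => //; exists X.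
exists E; split => // i Li; apply: contrapT => hi.
have Ai : forall j, E j -> ~ (B i `&` B j !=set0).
  by move=> j Ej ij; apply: hi; exact: Edom Ej ij.
pose A := [set j | L j /\ forall k, E k -> ~ (B j `&` B k !=set0)].
pose rA := [set r j | j in A].
have rAsup : has_sup rA.
  split; first by exists (r i); exists i.
  by exists b => _ [j [Lj _] <-]; have /andP[] := rb _ Lj.
have sup0 : 0 < sup rA.
  apply: (@lt_le_trans _ _ (r i)); first by have /andP[] := rb _ Li.
  by apply: ub_le_sup; [exact: rAsup.2|exists i].
(* Among the members disjoint from all of [E], [a] has more than half the supremal ratio, so adding
   it to [E] contradicts maximality. *)
have [_ [a [La Aa] <-] ra] := sup_adherent (divr_gt0 sup0 (ltr0Sn R 1)) rAsup.
have dom_a j : A j -> r j <= 2 * r a.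
  move=> Aj; have : r j <= sup rA by apply: ub_le_sup; [exact: rAsup.2|exists j].
  by move: ra; lra.
have nEa : ~ E a.
  by move=> Ea; apply: (Aa a Ea); rewrite setIid; exact: B0.
apply: (Emax (a |` E)).
  by split; [exact: subsetUr|move=> /(_ a) h; apply: nEa; apply: h; left].
split.
- by move=> j [->|/EL].
- have aE j : E j -> B a `&` B j = set0.
    by move=> Ej; apply/eqP/negPn/negP => /set0P; exact: Aa.
  move=> j k [->|Ej] [->|Ek] jk //; [exact: aE| |exact: Edisj].
  by rewrite setIC; exact: aE.
- move=> j k Lj Ek jk.
  have [[l [El jl]]|h] := pselect (exists l, E l /\ B j `&` B l !=set0).
    by have [m [Em jm rm]] := Edom _ _ Lj El jl; exists m; split => //; right.
  case: Ek => [ka|Ek]; last by case: h; exists k.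
  exists a; split; [by left|by rewrite -ka|].
  by apply: dom_a; split=> // l El jl; apply: h; exists l.
Qed.

(** * Equality for a set with small copies near each of its points *)

Section Core.
Variables (R : realType) (n : nat) (K : set 'rV[R]_n) (L : set nat).
Variables (f : nat -> 'rV[R]_n -> 'rV[R]_n) (r : nat -> R) (s C D : R).
Hypotheses (K0 : K !=set0) (Kc : seq_compact K) (s0 : 0 <= s) (C0 : 0 < C).
Hypothesis KD : forall x y, K x -> K y -> edist x y <= D.
Hypothesis r01 : forall k, L k -> 0 < r k < 1.
Hypothesis fr : forall k, L k -> forall x y, edist (f k x) (f k y) = r k * edist x y.
Hypothesis fK : forall k, L k -> f k @` K `<=` K.
Hypothesis approx : forall x e, K x -> 0 < e -> exists k, [/\ L k, r k < e &
  forall y, K y -> edist x (f k y) <= C * r k].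
Hypothesis s_dim : forall t, s < t -> exists t',
  [/\ 0 <= t', t' < t & hausdorff_content t' K = 0%E].

Let D0 : 0 <= D.
Proof. by have [x Kx] := K0; rewrite -(edistxx x); exact: KD. Qed.

(** Relative diameter of [ball k]: twice the radius 2 * C, plus the diameter bound of [K]. *)
Let c := 4 * C + D.

Let c0 : 0 < c. Proof. by rewrite ltr_wpDr// mulr_gt0. Qed.

(** Covers of [K] can be cut to sets of diameter at most [D], which [f k] shrinks below [d]. *)
Lemma pre_copy_le d k : L k -> r k * c <= d ->
  (hausdorff_pre s d%:E (f k @` K) <= (r k `^ s)%:E * hausdorff_content s K)%E.
Proof.
move=> Lk rkd; have /andP[rk0 _] := r01 Lk.
apply: (@le_trans _ _ (hausdorff_pre s ((r k)%:E * D%:E)%E (f k @` K))).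
  apply: hausdorff_pre_delta; rewrite -EFinM lee_fin; apply: le_trans rkd.
  by rewrite ler_wpM2l ?(ltW rk0)// lerDr mulr_ge0 ?(ltW C0).
apply: le_trans (hausdorff_pre_image_le rk0 (fr Lk) _ _ s0) _.
rewrite lee_wpmul2l ?lee_fin ?powR_ge0//; apply: hausdorff_pre_le_content => //.
by apply: diam_le => [|x y Kx Ky]; rewrite lee_fin ?KD.
Qed.

(** The factor 2 is Vitali's: a copy within C * r j of a point, with r j <= 2 * r k, meets the k-th
    one. *)
Let ball k := [set x | exists2 y, K y & edist x (f k y) <= 2 * C * r k].

Lemma pre_ball_le d k : L k -> r k * c <= d ->
  (hausdorff_pre s d%:E (ball k) <= (c `^ s)%:E * (r k `^ s)%:E)%E.
Proof.
move=> Lk rkd; have /andP[rk0 _] := r01 Lk.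
have bd : (diam (ball k) <= (r k * c)%:E)%E.
  apply: diam_le => [|x x' [y Ky xy] [y' Ky' xy']]; rewrite lee_fin.
    by rewrite mulr_ge0 ?ltW.
  have := edist_triangle (f k y) x x'; have := edist_triangle (f k y') (f k y) x'.
  rewrite fr// (edistC (f k y') x').
  have : r k * edist y y' <= r k * D by rewrite ler_wpM2l ?KD// ltW.
  rewrite /c; lra.
apply: (@le_trans _ _ (diam_pow s (ball k))).
  by apply: hausdorff_pre_le_diam_pow; apply: le_trans bd _; rewrite lee_fin.
by rewrite -EFinM -powRM ?(ltW c0) ?(ltW rk0)// mulrC -poweR_EFin; exact: diam_pow_le.
Qed.

Lemma content_eq_measure_of_copies : hausdorff_content s K = hausdorff_measure s K.
Proof.
apply/content_eq_measureP => d d0; apply/lee_addgt0Pr => e e0.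
pose L' := [set k | L k /\ r k * c <= d].
have [||E [EL Edisj Edom]] := @ex_vitali_subfamily R _ _ (fun k => f k @` K) r L' 1.
- by move=> k _; have [x Kx] := K0; exists (f k x); exact: imageP.
- by move=> k [/r01/andP[-> /ltW->]].
pose Ep : pred nat := fun k => `[< E k >].
have EpP k : Ep k -> E k by move/asboolP.
have EpL k : Ep k -> L k by move=> /EpP /EL[].
have Epd k : Ep k -> r k * c <= d by move=> /EpP /EL[].
have sumE N : \sum_(0 <= k < N | Ep k) r k `^ s <= 1.
  apply: (sum_ratio_le1 K0 Kc (f := f)) => //.
  - by move=> k /EpL; exact: r01.
  - by move=> k /EpL; exact: fr.
  - by move=> k /EpL; exact: fK.
  - by move=> k l /EpP Ek /EpP El; exact: Edisj.
have rs0 k : (0 <= (r k `^ s)%:E)%E by rewrite lee_fin powR_ge0.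
have ser_fin : (\sum_(0 <= k <oo | Ep k) (r k `^ s)%:E < +oo)%E.
  apply: (@le_lt_trans _ _ 1%E); last exact: ltry.
  apply: lime_le; first exact: is_cvg_nneseries.
  by apply: nearW => N; rewrite sumEFin lee_fin.
have cs0 : 0 < c `^ s by exact: powR_gt0.
have [N Ne] : exists N, (\sum_(N <= k <oo | Ep k) (r k `^ s)%:E <= (e / c `^ s)%:E)%E.
  have tail0 := nneseries_tail_cvg ser_fin (fun k _ => rs0 k).
  apply: contrapT => h.
  have : ((e / c `^ s)%:E <= 0)%E.
    rewrite -(cvg_lim _ tail0)//; apply: lime_ge; first exact: cvgP tail0.
    apply: nearW => N; rewrite leNgt; apply/negP => /ltW hN; apply: h.
    by exists N.
  by rewrite lee_fin leNgt divr_gt0.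
pose X m := if Ep m then (if (m < N)%N then f m @` K else ball m) else set0.
have KX : K `<=` \bigcup_m X m.
  move=> x Kx.
  have [[m [mN [Em fmx]]]|hx] := pselect (exists m, (m < N)%N /\ Ep m /\ (f m @` K) x).
    by exists m => //; rewrite /X Em mN.
  (* A point outside the first selected copies has a positive distance [eps] to them. A copy within
     less than [eps] of it cannot meet them, so the selected copy that dominates it has index at
     least [N], and its [ball] contains the point. *)
  have [k eps eps' h /andP[_ e'e] Ek y Ky|k kN|eps eps0 epsP] := @uniform_pos R N
    (fun k eps => Ep k -> forall y, K y -> eps <= edist x (f k y)).
  - exact: le_trans e'e (h Ek y Ky).
  - have [Ek|] := boolP (Ep k); last by exists 1.
    apply: contrapT => hk; apply: hx; exists k; split => //; split => //.
    have /andP[rk0 _] := r01 (EpL k Ek).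
    apply: (seq_compact_closed (seq_compact_image (fr (EpL k Ek)) rk0 Kc)) => eps eps0.
    apply: contrapT => hy; apply: hk; exists eps => // _ y Ky.
    rewrite leNgt; apply/negP => lt; apply: hy; exists (f k y); first exact: imageP.
    by rewrite edistC.
  have [|k [Lk rk kx]] := @approx x (Num.min (eps / C) (d / c)) Kx.
    by rewrite lt_min !divr_gt0.
  move: rk; rewrite lt_min !ltr_pdivlMr// => /andP[rkC rkc].
  have [|b [Eb [_ [[y Ky <-] [z Kz zy]]] rkb]] := Edom k; first by split; [|exact: ltW].
  have Epb : Ep b by apply/asboolP.
  have xz : edist x (f b z) <= C * r k by rewrite zy; exact: kx.
  exists b => //; rewrite /X Epb; case: ifPn => [bN|_].
    by have := epsP b bN Epb z Kz; lra.
  exists z => //; apply: le_trans xz _.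
  by rewrite -mulrA mulrCA ler_pM2l.
apply: le_trans (hausdorff_pre_subset _ _ KX) _.
apply: le_trans (hausdorff_pre_bigcup _ _ _) _.
pose g m : \bar R := (if Ep m then
  if (m < N)%N then (r m `^ s)%:E * hausdorff_content s K else (c `^ s)%:E * (r m `^ s)%:E
  else 0)%E.
have Xg m : (hausdorff_pre s d%:E (X m) <= g m)%E.
  rewrite /X /g; case: ifPn => Em.
    by case: ifPn => _; [apply: pre_copy_le|apply: pre_ball_le]; auto.
  apply: le_trans (hausdorff_pre_le_diam_pow _ _) _.
    by rewrite diam_set0 lee_fin ltW.
  by rewrite diam_pow_set0.
have g0 m : (0 <= g m)%E by apply: le_trans (Xg m); exact: hausdorff_pre_ge0.
apply: (@le_trans _ _ (\sum_(0 <= m <oo) g m)%E).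
  by apply: lee_nneseries => *; [exact: hausdorff_pre_ge0|exact: Xg].
(* The head is at most the content because the ratios^s add up to at most 1; the tail is at most [e]
   by the choice of [N]. *)
rewrite (nneseries_split 0 N)// add0n; apply: leeD.
  rewrite (@eq_big_nat _ _ _ _ _ _ (fun m =>
    if Ep m then (r m `^ s)%:E * hausdorff_content s K else 0)%E); last first.
    by move=> m /andP[_ mN]; rewrite /g mN.
  rewrite -big_mkcond/= -ge0_sume_distrl; last by move=> *; exact: rs0.
  rewrite sumEFin -[leRHS]mul1e lee_wpmul2r ?hausdorff_pre_ge0// lee_fin.
  exact: sumE.
rewrite [leLHS](_ : _ = \sum_(N <= m <oo)
    if Ep m then (c `^ s)%:E * (r m `^ s)%:E else 0)%E; last first.
  rewrite eseries_cond [RHS]eseries_cond; apply: eq_eseriesr => m /andP[_ Nm].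
  by rewrite /g ltnNge Nm.
rewrite -eseries_mkcond nneseriesZl// -lee_pdivlMl//.
by rewrite -EFinM mulrC.
Qed.

End Core.

(** * Words *)

Section Words.
Variable M : nat.
Implicit Types (a b : nat -> 'I_M) (w u v : seq 'I_M).

Definition shift k a : nat -> 'I_M := fun l => a (k + l)%N.

(** The default value of [nth] is the entry of [b] wanted beyond the end of [w]. *)
Definition conc w b : nat -> 'I_M := fun l => nth (b (l - size w)%N) w l.

Lemma prefix_word_add a k m :
  prefix_word a (k + m) = prefix_word a k ++ prefix_word (shift k a) m.
Proof.
rewrite /prefix_word /mkseq iotaD map_cat add0n -[X in iota X m]addn0 iotaDl.
by rewrite -map_comp.
Qed.

Lemma prefix_word_inj a b k : prefix_word a k = prefix_word b k ->
  forall l, (l < k)%N -> a l = b l.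
Proof.
by move=> ab l lk; have := congr1 (fun w => nth (a l) w l) ab; rewrite !nth_mkseq.
Qed.

Lemma prefix_word_conc w b : prefix_word (conc w b) (size w) = w.
Proof.
case: w => [//|i w]; apply: (@eq_from_nth _ i); rewrite size_mkseq// => l lw.
by rewrite nth_mkseq// /conc; exact: set_nth_default.
Qed.

Lemma shift_conc w b : shift (size w) (conc w b) = b.
Proof. by apply/funext => l; rewrite /shift /conc nth_default ?leq_addr// addKn. Qed.

Lemma conc_prefix0 a b k : b 0%N = a k -> conc (prefix_word a k) b 0%N = a 0%N.
Proof. by rewrite /conc size_mkseq; case: k => [|k] // ->. Qed.

Lemma conc_nil b : conc [::] b = b.
Proof. by apply/funext => l; rewrite /conc nth_nil subn0. Qed.

Lemma conc_cat u v b : conc (u ++ v) b = conc u (conc v b).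
Proof.
apply/funext => l; rewrite /conc size_cat nth_cat.
have [lu|ul] := ltnP l (size u); first exact: set_nth_default.
by rewrite [in RHS]nth_default// subnDA.
Qed.

Variable A : 'M[nat]_M.

Lemma subshift_shift a k : subshift A a -> subshift A (shift k a).
Proof. by move=> Aa l; rewrite /shift addnS; exact: Aa. Qed.

Lemma subshift_conc_prefix a b k : subshift A a -> subshift A b -> b 0%N = a k ->
  subshift A (conc (prefix_word a k) b).
Proof.
move=> Aa Ab ba l; rewrite /conc size_mkseq.
have [lk|kl] := ltnP l k; last first.
  by rewrite !nth_default ?size_mkseq ?(leqW kl)// subSn//; exact: Ab.
rewrite nth_mkseq//; move: lk; rewrite leq_eqVlt => /orP[/eqP lk|lk].
  by rewrite nth_default ?size_mkseq ?lk// subnn ba -lk; exact: Aa.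
by rewrite nth_mkseq//; exact: Aa.
Qed.

Lemma subshift_cons i b : subshift A b -> A i (b 0%N) = 1%N ->
  subshift A (conc [:: i] b).
Proof.
by move=> Ab Aib [|l]; rewrite /conc/= ?nth_nil ?subn1.
Qed.

(** A positive entry (j, i) of A^m yields a path of m steps from j to i; [u] omits the final i,
    which is the first letter of [b]. *)
Lemma ex_path i j : zero_one_matrix A -> irreducible_matrix A ->
  exists2 u, u <> [::] & forall b, subshift A b -> b 0%N = i ->
    subshift A (conc u b) /\ conc u b 0%N = j.
Proof.
move=> A01 Airr; have [m m0 Am] := Airr j i.
suff [u um uP] : exists2 u, size u = m & forall b, subshift A b -> b 0%N = i ->
    subshift A (conc u b) /\ conc u b 0%N = j.
  by exists u => // u0; rewrite -um u0 in m0.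
elim: m j {m0} Am => [|m IH] j.
  rewrite expr0 mxE; case: eqP => // -> _; exists [::] => // b Ab bi.
  by rewrite conc_nil.
rewrite exprS mxE => Am.
have [k /andP[jk ki]] : exists k, (0 < A j k)%N && (0 < (A ^+ m) k i)%N.
  apply/existsP; apply: contraTT Am; rewrite negb_exists => /forallP h.
  rewrite -leqNgt leqn0; apply/eqP; apply: big1 => k _.
  by have := h k; rewrite negb_and -!leqNgt !leqn0 => /orP[] /eqP->;
    rewrite ?mul0r ?mulr0.
have [u um uP] := IH _ ki; exists (j :: u); first by rewrite /= um.
move=> b Ab bi; have [Aub ub] := uP b Ab bi.
rewrite -cat1s conc_cat; split => //.
apply: subshift_cons => //; rewrite ub.
by case: (A01 j k) jk => ->.
Qed.

End Words.

(** * Coding map *)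

Section Coding.
Variables (R : realType) (n M : nat) (S : 'I_M -> 'rV[R]_n -> 'rV[R]_n).
Variables (ratio : 'I_M -> R) (q : R).
Hypothesis ratio01 : forall i, 0 < ratio i <= q.
Hypothesis q01 : 0 < q < 1.
Hypothesis S_ratio : forall i x y, edist (S i x) (S i y) = ratio i * edist x y.
Hypothesis S_cube : forall i, S i @` unit_cube `<=` unit_cube.
Implicit Types (a b : nat -> 'I_M) (w u v : seq 'I_M) (x y z : 'rV[R]_n).

Definition word_ratio w : R := \prod_(i <- w) ratio i.

Let q0 : 0 <= q. Proof. by have /andP[/ltW] := q01. Qed.

Lemma word_ratio_gt0 w : 0 < word_ratio w.
Proof. by apply: prodr_gt0 => i _; have /andP[] := ratio01 i. Qed.

Lemma word_ratio_le w : word_ratio w <= q ^+ size w.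
Proof.
rewrite /word_ratio; elim: w => [|i w IH]; first by rewrite big_nil expr0.
have /andP[i0 iq] := ratio01 i.
by rewrite big_cons exprS ler_pM ?(ltW i0)//; exact: ltW (word_ratio_gt0 w).
Qed.

Lemma word_map_ratio w x y :
  edist (word_map S w x) (word_map S w y) = word_ratio w * edist x y.
Proof.
rewrite /word_ratio; elim: w => [|i w IH]; first by rewrite big_nil mul1r.
by rewrite big_cons /= S_ratio IH mulrA.
Qed.

Lemma word_map_cat u v x : word_map S (u ++ v) x = word_map S u (word_map S v x).
Proof. by elim: u => //= i u ->. Qed.

Lemma word_map_cube w x : unit_cube x -> unit_cube (word_map S w x).
Proof. by move=> x01; elim: w => //= i w IH; apply: S_cube; exists (word_map S w x). Qed.

Lemma edist_cube x y : unit_cube x -> unit_cube y -> edist x y <= n%:R.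
Proof.
move=> x01 y01; rewrite -[leRHS]mulr1; apply: edist_le_coord => j.
by have := x01 j; have := y01 j; rewrite ler_norml; lra.
Qed.

Lemma geometric_small (c e : R) : 0 < e -> exists k : nat, c * q ^+ k < e.
Proof.
move=> e0; have [c0|c0] := leP c 0; first by exists 0%N; rewrite expr0 mulr1 (le_lt_trans c0).
have /andP[_ q1] := q01.
have := @cvg_expr R q; rewrite ger0_norm// => /(_ q1) /cvgrPdist_lt /(_ (e / c)).
case; first exact: divr_gt0.
move=> k _ /(_ k (leqnn k)) /=; rewrite sub0r normrN ger0_norm ?exprn_ge0// => h.
by exists k; rewrite mulrC -ltr_pdivlMr.
Qed.

Lemma geometric_eq (c : R) x y : (forall k, edist x y <= c * q ^+ k) -> x = y.
Proof.
move=> h; apply: edist_small_eq => e /(geometric_small c)[k ke].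
exact: le_lt_trans (h k) ke.
Qed.

(** The images of 0 form a Cauchy sequence. One factor n bounds the diameter of the cube, the other
    comes from [edist_complete]. *)
Lemma ex_limit_point a : exists2 z, unit_cube z &
  forall m, edist (word_map S (prefix_word a m) 0) z <= n%:R * (n%:R * q ^+ m).
Proof.
have cube0 : unit_cube (0 : 'rV[R]_n) by move=> j; rewrite mxE lexx ler01.
pose x m := word_map S (prefix_word a m) 0.
have xc m : unit_cube (x m) by exact: word_map_cube.
have [|z zP] := @edist_complete R n x (fun m => n%:R * q ^+ m).
  move=> m p mp; rewrite /x -(subnKC mp) prefix_word_add word_map_cat word_map_ratio.
  rewrite mulrC ler_pM ?edist_ge0 ?(ltW (word_ratio_gt0 _))//.
    by apply: edist_cube => //; exact: word_map_cube.
  by apply: le_trans (word_ratio_le _) _; rewrite size_mkseq.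
exists z => // j; suff h e : 0 < e -> - e <= z ord0 j <= 1 + e.
  apply/andP; split; first by apply/ler_addgt0Pl => e /h; lra.
  by apply/ler_addgt0Pl => e /h; lra.
move=> /(geometric_small (n%:R * n%:R))[m]; rewrite -mulrA => me.
have := le_lt_trans (le_trans (ler_coord_edist _ _ j) (zP m)) me.
by rewrite ltr_norml; have := xc m j; lra.
Qed.

(** The limit point lies in the intersection defining [coding], so [xget] does not return its
    default; the shrinking images then force both points to agree. *)
Lemma codingP a :
  unit_cube (coding S a) /\
  forall k, coding S a = word_map S (prefix_word a k) (coding S (shift k a)).
Proof.
have /choice[z zP] b : exists z, unit_cube z /\
    forall m, edist (word_map S (prefix_word b m) 0) z <= n%:R * (n%:R * q ^+ m).
  by have [z ? ?] := ex_limit_point b; exists z.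
have zshift b k : z b = word_map S (prefix_word b k) (z (shift k b)).
  apply: (@geometric_eq (n%:R * n%:R *+ 2)) => m.
  have h1 := (zP b).2 (k + m)%N; have h2 := (zP (shift k b)).2 m.
  apply: le_trans (edist_triangle (word_map S (prefix_word b (k + m)) 0) _ _) _.
  rewrite mulrnAl mulr2n lerD//.
    rewrite edistC; apply: le_trans h1 _; rewrite mulrA ler_wpM2l ?mulr_ge0//.
    by rewrite exprD ler_piMl ?exprn_ge0// exprn_ile1//; have /andP[_ /ltW] := q01.
  rewrite prefix_word_add word_map_cat word_map_ratio.
  rewrite -mulrA -[leRHS]mul1r ler_pM ?edist_ge0 ?(ltW (word_ratio_gt0 _))//.
  apply: le_trans (word_ratio_le _) _; rewrite exprn_ile1//.
  by have /andP[_ /ltW] := q01.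
suff cz b : coding S b = z b.
  by rewrite cz; split=> [|k]; [exact: (zP a).1|rewrite cz; exact: zshift].
have zcap : (\bigcap_(k in [set k | (0 < k)%N])
    (word_map S (prefix_word b k) @` unit_cube)) (z b).
  by move=> k _; exists (z (shift k b)); [exact: (zP _).1|rewrite -zshift].
have ccap := xgetI 0 zcap.
apply: (@geometric_eq n%:R) => k.
have qk : q ^+ k.+1 <= q ^+ k.
  by rewrite exprS ler_piMl ?exprn_ge0//; have /andP[_ /ltW] := q01.
(* Level k + 1, since the intersection ranges over positive levels only. *)
have [x xc xE] := ccap k.+1 (ltn0Sn k); have [y yc yE] := zcap k.+1 (ltn0Sn k).
rewrite {1}/coding -xE -yE word_map_ratio mulrC ler_pM ?edist_ge0 ?(ltW (word_ratio_gt0 _))//.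
  exact: edist_cube.
by apply: le_trans (word_ratio_le _) _; rewrite size_mkseq.
Qed.

Lemma coding_cube a : unit_cube (coding S a).
Proof. by have [] := codingP a. Qed.

Lemma coding_conc w b : coding S (conc w b) = word_map S w (coding S b).
Proof.
by have [_ /(_ (size w)) ->] := codingP (conc w b); rewrite prefix_word_conc shift_conc.
Qed.

Lemma coding_prefix_edist a b k : prefix_word a k = prefix_word b k ->
  edist (coding S a) (coding S b) <= n%:R * q ^+ k.
Proof.
move=> ab; have [_ /(_ k) ->] := codingP a; have [_ /(_ k) ->] := codingP b.
rewrite ab word_map_ratio mulrC ler_pM ?edist_ge0 ?(ltW (word_ratio_gt0 _))//.
  by apply: edist_cube; exact: coding_cube.
by apply: le_trans (word_ratio_le _) _; rewrite size_mkseq.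
Qed.

Variable A : 'M[nat]_M.

(** The transition out of i is kept as a condition on [b], so that empty [v] is included and yields
    the union of the successor pieces. *)
Lemma attractor_cyl_cons i v : sft_attractor_cyl S A (i :: v) =
  S i @` (coding S @` [set b | [/\ subshift A b, cylinder v b & A i (b 0%N) = 1%N]]).
Proof.
apply/seteqP; split=> [_ [a [Aa av] <-]|_ [_ [b [Ab bv ib] <-] <-]].
  have := av; rewrite /cylinder/= -addn1 addnC prefix_word_add => -[a0 sv].
  exists (coding S (shift 1 a)).
    exists (shift 1 a) => //; split => //; first exact: subshift_shift.
    by rewrite /shift/= -a0; exact: Aa.
  by have [_ /(_ 1%N) ->] := codingP a; rewrite /= a0.
exists (conc [:: i] b); last by rewrite coding_conc.
split; first exact: subshift_cons.
rewrite /cylinder/= -addn1 addnC prefix_word_add -[1%N]/(size [:: i]).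
by rewrite prefix_word_conc shift_conc/= bv.
Qed.

(* Koenig's lemma: [prefix_word b k] is chosen so that infinitely many of the
   codes of the given points start with it. *)
Lemma attractor_cyl1_seq_compact i : seq_compact (sft_attractor_cyl S A [:: i]).
Proof.
move=> x xK.
have /choice[a aP] m : exists a, (subshift A a /\ cylinder [:: i] a) /\ coding S a = x m.
  by have [a ? ?] := xK m; exists a.
pose Q v := forall N : nat, exists2 m : nat, (N <= m)%N & prefix_word (a m) (size v) = v.
have Qrcons v : Q v -> exists j, Q (rcons v j).
  move=> Qv; apply: contrapT => h.
  have /choice[N NP] j : exists N : nat, forall m : nat, (N <= m)%N ->
      prefix_word (a m) (size (rcons v j)) <> rcons v j.
    apply: contrapT => hj; apply: h; exists j => N; apply: contrapT => hN.
    by apply: hj; exists N => m Nm e; apply: hN; exists m.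
  (* Beyond all the bounds [N j], whichever letter follows [v] violates its own bound. *)
  have [m Nm mv] := Qv (\max_j N j)%N.
  have Nj : (N (a m (size v)) <= m)%N by apply: leq_trans Nm; exact: leq_bigmax.
  apply: (NP _ m Nj); by rewrite size_rcons /prefix_word mkseqS -/(prefix_word _ _) mv.
pose st := {v | Q v}.
have step (p : st) : {p' : st | exists j, sval p' = rcons (sval p) j}.
  by apply: cid; have [j Qj] := Qrcons _ (svalP p); exists (exist _ _ Qj), j.
have Qnil : Q [::] by move=> N; exists N.
have [v [v0 vS]] := dependent_choice step (exist _ [::] Qnil).
pose b k := last i (sval (v k.+1)).
have vb k : sval (v k) = prefix_word b k.
  elim: k => [|k IH]; first by rewrite v0.
  have [j vj] := vS k; rewrite /prefix_word mkseqS -/(prefix_word _ _) -IH.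
  by rewrite /b vj last_rcons.
have bQ k N : exists2 m : nat, (N <= m)%N & prefix_word (a m) k = prefix_word b k.
  by have := svalP (v k) N; rewrite vb size_mkseq.
exists (coding S b).
  exists b => //; split.
    (* A transition involves the letters l and l + 1, hence a prefix of length l + 2. *)
    move=> l; have [m _ /prefix_word_inj mb] := bQ l.+2 0%N.
    by rewrite -!mb//; exact: (aP m).1.1.
  by have [m _ mb] := bQ 1%N 0%N; rewrite /cylinder/= -mb; exact: (aP m).1.2.
move=> e e0 N; have [k ke] := geometric_small n%:R e0.
have [m Nm mb] := bQ k N; exists m => //.
by rewrite -(aP m).2; exact: le_lt_trans (coding_prefix_edist mb) ke.
Qed.

(** Makes the infimum in [hausdorff_dim] one over a nonempty set. The exponent k satisfies M * q^k <
    1/2, so passing from scale d to q * d at least halves the premeasure. *)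
Lemma ex_hausdorff_measure0 : exists2 t, 0 <= t &
  hausdorff_measure t (sft_attractor S A) = 0%E.
Proof.
set F := sft_attractor S A.
have [|k kM] := @geometric_small M%:R 2^-1; first by rewrite invr_gt0.
pose t : R := k%:R; have t0 : 0 <= t by rewrite ler0n.
have qt : q `^ t = q ^+ k by rewrite powR_mulrn.
pose h d := hausdorff_pre t d%:E F.
have h0 d : (0 <= h d)%E by exact: hausdorff_pre_ge0.
have /andP[q_gt0 q1] := q01.
have hq (d : R) : 0 <= d -> (h (q * d)%R <= (2^-1)%:E * h d)%E.
  move=> d0; pose X m := if insub m is Some i then S i @` F else set0.
  have FX : F `<=` \bigcup_m X m.
    move=> _ [a Aa <-]; exists (val (a 0%N)) => //; rewrite /X valK.
    exists (coding S (shift 1 a)); first by exists (shift 1 a) => //; exact: subshift_shift.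
    by have [_ /(_ 1%N) ->] := codingP a.
  have X_le m : (hausdorff_pre t (q * d)%R%:E (X m) <= (q ^+ k)%:E * h d)%E.
    rewrite /X; case: insubP => [i _ _|_]; last first.
      apply: le_trans (hausdorff_pre_le_diam_pow _ _) _.
        by rewrite diam_set0 lee_fin mulr_ge0.
      by rewrite diam_pow_set0 mule_ge0// lee_fin exprn_ge0.
    have /andP[i0 iq] := ratio01 i.
    apply: (@le_trans _ _ (hausdorff_pre t ((ratio i)%:E * d%:E)%E (S i @` F))).
      by apply: hausdorff_pre_delta; rewrite -EFinM lee_fin ler_wpM2r.
    apply: le_trans (hausdorff_pre_image_le i0 (S_ratio i) _ _ t0) _.
    apply: lee_wpmul2r; first exact: h0.
    rewrite lee_fin -qt.
    by apply: ge0_ler_powR => //; rewrite nnegrE// ltW.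
  apply: le_trans (hausdorff_pre_subset _ _ FX) _.
  apply: le_trans (hausdorff_pre_bigcup _ _ _) _.
  rewrite (nneseries_split 0 M)//; last by move=> *; exact: hausdorff_pre_ge0.
  rewrite add0n [X in (_ + X)%E]eseries0 ?adde0; last first.
    move=> m Mm _; rewrite /X insubF ?ltnNge ?Mm//.
    apply/le_anti; rewrite hausdorff_pre_ge0 andbT -(@diam_pow_set0 R n t).
    by rewrite hausdorff_pre_le_diam_pow// diam_set0 lee_fin mulr_ge0.
  apply: (@le_trans _ _ (\sum_(0 <= m < M) ((q ^+ k)%:E * h d))%E).
    by apply: lee_sum => m _; exact: X_le.
  rewrite -ge0_sume_distrl => [|*]; last by rewrite lee_fin exprn_ge0.
  rewrite sumEFin sumr_const_nat subn0 -[_ *+ M]mulr_natl.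
  by apply: lee_wpmul2r; [exact: h0|rewrite lee_fin ltW].
(* At scale n the premeasure is finite, and it is at most its value at the smaller scale q * n,
   hence at most half of itself. *)
have hD : h n%:R = 0%E.
  have hfin : (h n%:R <= (n%:R `^ t)%:E)%E.
    have Fn : (diam F <= n%:R%:E)%E.
      apply: diam_le => [|_ _ [a _ <-] [b _ <-]]; rewrite lee_fin ?ler0n//.
      by apply: edist_cube; exact: coding_cube.
    apply: le_trans (hausdorff_pre_le_diam_pow _ Fn) _.
    by rewrite -poweR_EFin; exact: diam_pow_le.
  have h_fin : h n%:R \is a fin_num by rewrite ge0_fin_numE// (le_lt_trans hfin) ?ltry.
  have : (h n%:R <= (2^-1)%:E * h n%:R)%E.
    apply: le_trans (hq _ (ler0n _ _)); apply: hausdorff_pre_delta.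
    by rewrite lee_fin ler_piMl// ltW.
  have := h0 n%:R; rewrite -(fineK h_fin) -EFinM !lee_fin => f0 fh.
  by congr (_%:E); apply/le_anti; rewrite f0 andbT; lra.
have hqm m : h (q ^+ m * n%:R) = 0%E.
  elim: m => [|m IH]; first by rewrite expr0 mul1r.
  apply/le_anti; rewrite h0 andbT exprS -mulrA; apply: le_trans (hq _ _) _.
    by rewrite mulr_ge0 ?exprn_ge0.
  by rewrite IH mule0.
exists t => //; apply/le_anti/andP; split; last first.
  rewrite hausdorff_measureE; apply: le_trans (h0 1) _.
  by apply: ereal_sup_ubound; exists 1 => /=.
rewrite hausdorff_measureE; apply: ge_ereal_sup => _ [d /= d0 <-].
have [m md] := geometric_small n%:R d0.
by rewrite -(hqm m) hausdorff_pre_delta// lee_fin mulrC ltW.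
Qed.

End Coding.

(** * Cylinders of the attractor *)

Section Letter.
Variables (R : realType) (n M : nat) (S : 'I_M -> 'rV[R]_n -> 'rV[R]_n).
Variables (ratio : 'I_M -> R) (q : R) (A : 'M[nat]_M).
Hypothesis ratio01 : forall i, 0 < ratio i <= q.
Hypothesis q01 : 0 < q < 1.
Hypothesis S_ratio : forall i x y, edist (S i x) (S i y) = ratio i * edist x y.
Hypothesis S_cube : forall i, S i @` unit_cube `<=` unit_cube.
Hypothesis A_01 : zero_one_matrix A.
Hypothesis A_irreducible : irreducible_matrix A.

Let F := sft_attractor S A.
Let s := hausdorff_dim F.

Let dim_set : set R := [set t | 0 <= t /\ hausdorff_measure t F = 0%E].

Let dim_set_inf : has_inf dim_set.
Proof.
split; last by exists 0 => t [].
have [t t0 Ft] := ex_hausdorff_measure0 ratio01 q01 S_ratio S_cube A.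
by exists t.
Qed.

Lemma hausdorff_dim_ge0 : 0 <= s.
Proof. by apply: lb_le_inf => [|t []//]; exact: dim_set_inf.1. Qed.

(** Monotonicity passes null exponents of the whole attractor on to its pieces. *)
Lemma hausdorff_dim_lt (X : set 'rV[R]_n) t : X `<=` F -> s < t -> exists t',
  [/\ 0 <= t', t' < t & hausdorff_content t' X = 0%E].
Proof.
move=> XF st; have [|t' [t'0 Ft'] t't] := @inf_adherent R dim_set (t - s) _ dim_set_inf.
  by rewrite subr_gt0.
exists t'; split=> //.
  by move: t't; rewrite /s /hausdorff_dim -/dim_set addrC subrK.
apply/le_anti; rewrite hausdorff_pre_ge0 andbT -Ft' hausdorff_measureE.
apply: le_trans (hausdorff_pre_subset _ _ XF) _.
apply: (@le_trans _ _ (hausdorff_pre t' 1%:E F)).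
  by apply: hausdorff_pre_delta; exact: leey.
by apply: ereal_sup_ubound; exists 1 => /=.
Qed.

Lemma content_eq_measure_letter i :
  hausdorff_content s (sft_attractor_cyl S A [:: i]) =
  hausdorff_measure s (sft_attractor_cyl S A [:: i]).
Proof.
set K := sft_attractor_cyl S A [:: i].
have [->|/set0P K0] := eqVneq K set0; first exact: content_eq_measure_set0.
have KF : K `<=` F by move=> _ [a [Aa _] <-]; exists a.
have KP x : K x -> exists a, [/\ subshift A a, a 0%N = i & coding S a = x].
  by move=> [a [Aa [ai]] <-]; exists a.
have PK a : subshift A a -> a 0%N = i -> K (coding S a).
  by move=> Aa ai; exists a => //; split=> //; rewrite /cylinder/prefix_word/mkseq/= ai.
pose loop w := w <> [::] /\ forall b, subshift A b -> b 0%N = i ->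
  subshift A (conc w b) /\ conc w b 0%N = i.
(* The covering argument indexes copies by naturals, so words are enumerated; a non-code gives the
   empty word, which [loop] excludes. *)
pose word k : seq 'I_M := odflt [::] (unpickle k).
have wordK w : word (pickle w) = w by rewrite /word pickleK.
have /choice[u uP] j : exists u, u <> [::] /\ forall b, subshift A b -> b 0%N = i ->
    subshift A (conc u b) /\ conc u b 0%N = j.
  by have [u ? ?] := ex_path i j A_01 A_irreducible; exists u.
have wr0 w : 0 < word_ratio ratio w by exact: (word_ratio_gt0 ratio01).
(* Bounds the loss from all the return words at once; the 1 makes it positive. *)
pose C := 1 + \sum_j n%:R / word_ratio ratio (u j).
have C_ge j : n%:R / word_ratio ratio (u j) <= C.
  rewrite /C (bigD1 j)//= addrCA lerDl addr_ge0// sumr_ge0// => l _.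
  by rewrite divr_ge0// ltW.
have C0 : 0 < C.
  by rewrite ltr_pwDl// sumr_ge0// => l _; rewrite divr_ge0// ltW.
have cc a : unit_cube (coding S a) by exact: (coding_cube ratio01 q01 S_ratio S_cube).
have cconc w a : coding S (conc w a) = word_map S w (coding S a).
  exact: (coding_conc ratio01 q01 S_ratio S_cube).
apply: (@content_eq_measure_of_copies R n K [set k | loop (word k)]
  (fun k => word_map S (word k)) (fun k => word_ratio ratio (word k)) s C n%:R) => //.
- exact: (attractor_cyl1_seq_compact ratio01 q01 S_ratio S_cube).
- exact: hausdorff_dim_ge0.
- by move=> _ _ /KP[a [_ _ <-]] /KP[b [_ _ <-]]; exact: edist_cube.
- move=> k [w0 _]; rewrite wr0 /=; apply: le_lt_trans (word_ratio_le ratio01 _) _.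
  case: (word k) w0 => // j w _ /=; have /andP[q0 q1] := q01.
  by rewrite exprn_ilt1 ?ltW.
- by move=> k _; exact: word_map_ratio.
- move=> k [_ kl] _ [_ /KP[a [Aa ai <-]] <-]; rewrite -cconc.
  by have [? ?] := kl a Aa ai; exact: PK.
- move=> _ e /KP[a [Aa ai <-]] e0.
  have [k ke] := geometric_small q01 1 e0; rewrite mul1r in ke.
  (* A long prefix of the code of the point, closed into a loop by the return word from [a k] to
     [i]. *)
  pose p := prefix_word a k; pose w := p ++ u (a k).
  have wrE : word_ratio ratio w = word_ratio ratio p * word_ratio ratio (u (a k)).
    exact: big_cat.
  have pq : word_ratio ratio p <= q ^+ k.
    by have := word_ratio_le ratio01 p; rewrite size_mkseq.
  exists (pickle w); rewrite /= !wordK; split.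
  + split=> [/(congr1 size)|b Ab bi].
      rewrite size_cat; case: (u (a k)) (uP (a k)).1 => // l v _ /=.
      by rewrite addnS.
    have [Aub ub] := (uP (a k)).2 b Ab bi; rewrite conc_cat; split.
      exact: subshift_conc_prefix.
    by rewrite -ai; exact: conc_prefix0.
  + apply: le_lt_trans ke; apply: le_trans pq.
    rewrite wrE ler_piMr ?(ltW (wr0 _))//.
    apply: le_trans (word_ratio_le ratio01 _) _.
    by have /andP[q0 q1] := q01; rewrite exprn_ile1 ?ltW.
  (* Both points lie in the image of the cube under the prefix [p], of diameter at most n times the
     ratio of [p]; dividing by the ratio of the return word gives [C]. *)
  + move=> _ /KP[b [Ab bi <-]]; rewrite -cconc conc_cat cconc.
    have [_ /(_ k) ->] := codingP ratio01 q01 S_ratio S_cube a.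
    rewrite (word_map_ratio S_ratio) wrE mulrCA ler_pM2l//.
    apply: (@le_trans _ _ n%:R); first exact: edist_cube.
    by rewrite -ler_pdivrMr.
- by move=> t; exact: hausdorff_dim_lt.
Qed.

(** Removing the first letter leaves a similar copy of the shorter piece, or the empty set if the
    first transition is forbidden. *)
Lemma content_eq_measure_word i w :
  hausdorff_content s (sft_attractor_cyl S A (i :: w)) =
  hausdorff_measure s (sft_attractor_cyl S A (i :: w)).
Proof.
elim: w i => [|j w IH] i; first exact: content_eq_measure_letter.
have /andP[i0 _] := ratio01 i.
rewrite (attractor_cyl_cons ratio01 q01 S_ratio S_cube).
apply/(content_eq_measure_image i0 hausdorff_dim_ge0 (S_ratio i)).
have [ij|ij] := A_01 i j.
  rewrite (_ : [set b | _] = set0) ?image_set0; first exact: content_eq_measure_set0.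
  by apply/seteqP; split=> // b [_ [bj _]]; rewrite bj ij.
rewrite (_ : [set b | _] = subshift A `&` cylinder (j :: w)); first exact: IH.
apply/seteqP; split=> b; first by case.
by move=> [Ab bw]; split => //; case: bw => -> _.
Qed.

(** The similarity [S i] maps this union onto the piece of the one-letter word i. *)
Lemma content_eq_measure_successors i :
  hausdorff_content s
    (\bigcup_(j in [set j | A i j = 1%N]) sft_attractor_cyl S A [:: j]) =
  hausdorff_measure s
    (\bigcup_(j in [set j | A i j = 1%N]) sft_attractor_cyl S A [:: j]).
Proof.
have /andP[i0 _] := ratio01 i.
apply/(content_eq_measure_image i0 hausdorff_dim_ge0 (S_ratio i)).
rewrite (_ : S i @` _ = sft_attractor_cyl S A [:: i]).
  exact: content_eq_measure_letter.
rewrite (attractor_cyl_cons ratio01 q01 S_ratio S_cube); congr image.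
apply/seteqP; split=> [_ [j ij [b [Ab [bj]] <-]]|_ [b [Ab _ ib] <-]].
  by exists b => //; split => //; rewrite bj.
by exists (b 0%N) => //; exists b.
Qed.

End Letter.

Theorem theorem2p1 (R : realType) (n M : nat)
    (S : 'I_M -> 'rV[R]_n -> 'rV[R]_n) (A : 'M[nat]_M) (s : R)
    (S_similarity : forall i, contracting_similarity (S i))
    (S_cube : forall i, S i @` unit_cube `<=` unit_cube)
    (A_01 : zero_one_matrix A)
    (A_irreducible : irreducible_matrix A)
    (s_dim : s = hausdorff_dim (sft_attractor S A)) :
  (forall w : seq 'I_M, w <> [::] ->
     hausdorff_content s (sft_attractor_cyl S A w) =
     hausdorff_measure s (sft_attractor_cyl S A w)) /\
  (forall i : 'I_M,
     hausdorff_content s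
       (\bigcup_(j in [set j | A i j = 1%N]) sft_attractor_cyl S A [:: j]) =
     hausdorff_measure s
       (\bigcup_(j in [set j | A i j = 1%N]) sft_attractor_cyl S A [:: j])).
Proof.
have /choice[ratio ratioP] i : exists r : R, (0 < r < 1) /\
    forall x y, edist (S i x) (S i y) = r * edist x y.
  by have [r ? ?] := S_similarity i; exists r.
(* Starting the maximum at 1/2 keeps [q] strictly between 0 and 1 even for an empty alphabet. *)
pose q := \big[Num.max/2^-1]_i ratio i.
have ratio01 i : 0 < ratio i <= q.
  by have [/andP[-> _] _] := ratioP i; exact: le_bigmax.
have q01 : 0 < q < 1.
  apply/andP; split.
    by apply: lt_le_trans (bigmax_ge_id _ _ _ _); rewrite invr_gt0.
  apply: bigmax_lt => [|i _]; first by rewrite invf_lt1 ?ltr1n.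
  by have [/andP[]] := ratioP i.
have S_ratio i := (ratioP i).2.
rewrite s_dim; split=> [[//|i w] _|i].
  exact: (content_eq_measure_word ratio01 q01).
exact: (content_eq_measure_successors ratio01 q01).
Qed.
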